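(* Let $\lambda\vdash n$, let $M^\lambda$ be the $\mathfrak{S}_n$-permutation module with basis $\mathcal{B}$ the set of tabloids of shape $\lambda$, and let $\le$ be any total order on $\mathcal{B}$ extending the partial order $\vartriangleleft$ on tabloids. Then $(M^\lambda,\mathcal{B},\le)$ is strongly quasisymmetric characteristic compatible.
   Context: Tabloids of shape $\lambda$: row-equivalence classes of fillings of the (French-notation, bottom row longest) Young diagram of $\lambda$ by $1,\dots,n$; $s_i$ acts by swapping letters $i,i+1$. For tabloids $\{s\}\neq\{t\}$, $\{s\}\vartriangleleft\{t\}$ means the smallest letter lying in different rows of $\{s\}$ and $\{t\}$ lies in a higher row in $\{t\}$ than in $\{s\}$. Strong quasisymmetric characteristic compatibility (SQCC): let $M$ be a finite-dimensional $\mathfrak{S}_n$-module with basis $\mathcal{B}=\{v_1,\dots,v_k\}$ totally ordered $v_1\le\cdots\le v_k$. For $w=\sum c_jv_j\neq0$, its trailing term $\mathrm{tt}(w)$ is $c_jv_j$ for the $\le$-smallest $v_j$ with $c_j\neq0$. Define $\overline{\pi}_i$ on $\mathcal{B}$ (extended linearly) by: $\overline{\pi}_i(v_t)=0$ if $\mathrm{tt}(s_iv_t)=v_t$; $\overline{\pi}_i(v_t)=-v_t$ if $s_iv_t=v_j$ for some $v_j>v_t$ or $s_iv_t=-v_t$; $\overline{\pi}_i(v_t)=s_iv_t$ if $s_iv_t=v_j$ for some $v_j<v_t$ — assuming every basis element falls in one of these cases. If these $\overline{\pi}_i$ define an $\mathcal{H}_n(0)$-action (i.e., satisfy $\overline{\pi}_i^2=-\overline{\pi}_i$,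 $\overline{\pi}_i\overline{\pi}_j=\overline{\pi}_j\overline{\pi}_i$ for $|i-j|\ge2$, and $\overline{\pi}_i\overline{\pi}_{i+1}\overline{\pi}_i=\overline{\pi}_{i+1}\overline{\pi}_i\overline{\pi}_{i+1}$), call the resulting module $\widehat{M}$; $(M,\mathcal{B},\le)$ is SQCC if this holds and $F^Q_{char}(\widehat M)=F_{char}(M)$. Here, for $I\subseteq[n-1]$, $C_I$ is the one-dimensional $\mathcal{H}_n(0)$-module with $\overline{\pi}_i$ acting by $-1$ if $i\in I$, $0$ otherwise; $F^Q_{char}(N)=\sum_jF_{I_j}$ if $N$ has composition factors $C_{I_1},\dots,C_{I_m}$, with $F_I=\sum x_{i_1}\cdots x_{i_n}$ over $1\le i_1\le\cdots\le i_n$, $i_j<i_{j+1}$ for $j\in I$; $F_{char}$ is the Frobenius characteristic sending Specht modules $S^\mu$ to Schur functions $s_\mu$. *)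

(* Defs.v *)
From HB Require Import structures.
From mathcomp Require Import all_boot all_order all_algebra all_fingroup.
From mathcomp Require Import all_character.
From mathcomp Require Import mpoly.

Set Implicit Arguments.
Unset Strict Implicit.
Unset Printing Implicit Defensive.

Import GRing.Theory.
Local Open Scope ring_scope.

(* Letters are 'I_n, so the letter k of {1, ..., n} is the ordinal k - 1, and
   the index i of {1, ..., n-1} is the ordinal i - 1 of 'I_n.-1. *)
Section Letters.
Variable n : nat.
Implicit Type i : 'I_n.-1.

Fact letter_subproof i : (i < n)%N.
Proof. by apply: leq_trans (ltn_ord i) (leq_pred n). Qed.

Fact letter_succ_subproof i : (i.+1 < n)%N.
Proof. by rewrite -ltn_predRL. Qed.

Definition letter i : 'I_n := Ordinal (letter_subproof i).
Definition letter_succ i : 'I_n := Ordinal (letter_succ_subproof i).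

Definition simple_transp i : 'S_n := tperm (letter i) (letter_succ i).

End Letters.

(** * Partitions, tableaux and tabloids *)

Record intpartn (n : nat) := IntPartn {
  parts :> seq nat;
  partsP : [&& sorted geq parts, 0%N \notin parts & sumn parts == n]
}.

Section Shapes.
Variables (n : nat) (la : intpartn n).

(* Rows are numbered from the bottom one (the longest, in French notation), so
   that a larger row index means a higher row. *)
Definition cell := {r : 'I_(size la) & 'I_(nth 0%N la r)}.
Definition row_of (c : cell) : 'I_(size la) := tag c.
Definition col_of (c : cell) : nat := tagged c.

Lemma card_cell : #|{: cell}| = n.
Proof.
rewrite card_tagged sumnE big_map big_enum /=.
under eq_bigr => r _ do rewrite card_ord.
have /and3P[_ _ /eqP sum_la] := partsP la.
by rewrite -[RHS]sum_la sumnE (big_nth 0%N) big_mkord.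
Qed.

(* A filling is recorded by the cell [T x] in which each letter [x] lies; by
   [card_cell], injectivity amounts to bijectivity. *)
Definition is_tableau (T : {ffun 'I_n -> cell}) : bool := injectiveb T.
Definition tableau := {T : {ffun 'I_n -> cell} | is_tableau T}.

Lemma tableau_inj (T : tableau) : injective (val T).
Proof. exact/injectiveP/(valP T). Qed.

Definition row_equiv (T T' : tableau) : Prop :=
  forall r : 'I_(size la),
    [set x | row_of (val T x) == r] = [set x | row_of (val T' x) == r].

(* A row-equivalence class of fillings is recorded by the row in which each
   letter lies; see [tabloid_of_eq] and [tabloid_of_surj]. *)
Definition is_tabloid (t : {ffun 'I_n -> 'I_(size la)}) : bool :=
  [forall r, #|[set x | t x == r]| == nth 0%N la r].
Definition tabloid := {t : {ffun 'I_n -> 'I_(size la)} | is_tabloid t}.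

Lemma card_row (r : 'I_(size la)) :
  #|[set c : cell | row_of c == r]| = nth 0%N la r.
Proof.
pose f (j : 'I_(nth 0%N la r)) : cell := Tagged _ j.
have fI : injective f by apply: eq_from_Tagged.
rewrite -[RHS]card_ord -(card_imset predT fI).
apply: eq_card => c; rewrite inE; apply/eqP/imsetP => [|[j _ ->]] //.
by case: c => r' j def_r; rewrite /row_of /= in def_r; subst r'; exists j.
Qed.

Fact tabloid_of_subproof (T : tableau) :
  is_tabloid [ffun x => row_of (val T x)].
Proof.
apply/forallP=> r; rewrite -card_row -(card_imset _ (tableau_inj (T := T))).
apply/eqP/eq_card=> c; rewrite inE.
have [g _ Tg] : bijective (val T).
  by apply: (inj_card_bij (tableau_inj (T := T))); rewrite card_cell card_ord.
apply/imsetP/eqP => [[x] | <-]; first by rewrite inE ffunE => /eqP <- ->.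
by exists (g c); rewrite ?inE ?ffunE Tg.
Qed.

Definition tabloid_of (T : tableau) : tabloid :=
  exist is_tabloid _ (tabloid_of_subproof T).

Lemma tabloid_of_eq (T T' : tableau) :
  tabloid_of T = tabloid_of T' <-> row_equiv T T'.
Proof.
split=> [/(congr1 val)/ffunP eqTT' r | eqTT'].
  by apply/setP=> x; have := eqTT' x; rewrite !inE !ffunE => ->.
apply/val_inj/ffunP=> x; rewrite !ffunE; apply/esym/eqP.
by have /setP/(_ x) := eqTT' (row_of (val T x)); rewrite !inE eqxx => <-.
Qed.

Lemma tabloid_of_surj (t : tabloid) : exists T, tabloid_of T = t.
Proof.
pose R x := enum [set y | val t y == val t x].
have ltR x : (index x (R x) < nth 0%N la (val t x))%N.
  have /forallP/(_ (val t x))/eqP <- := valP t.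
  by rewrite cardE index_mem mem_enum inE.
pose T := [ffun x => Tagged (fun r : 'I_(size la) => 'I_(nth 0%N la r))
                            (Ordinal (ltR x)) : cell].
have TI : is_tableau T.
  apply/injectiveP=> x y eqT.
  have /(congr1 row_of) := eqT; rewrite !ffunE /row_of /= => eq_r.
  have /(congr1 col_of) := eqT; rewrite !ffunE /col_of /= => eq_c.
  have eqR : R x = R y by rewrite /R eq_r.
  have xR z : z \in R z by rewrite mem_enum inE.
  apply: (index_inj x (xR x)); first by rewrite eqR.
  by rewrite eq_c -eqR.
by exists (exist is_tableau T TI); apply/val_inj/ffunP=> x; rewrite !ffunE.
Qed.

(* The letter [g x] of the image lies where [x] was. MathComp composes
   permutations from left to right, so this is a right action, i.e. the left
   action for the usual composition. *)
Fact act_tableau_subproof (T : tableau) (g : 'S_n) :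
  is_tableau [ffun x => val T (g^-1%g x)].
Proof.
by apply/injectiveP=> x y; rewrite !ffunE => /(tableau_inj (T := T))/perm_inj.
Qed.

Definition act_tableau (T : tableau) (g : 'S_n) : tableau :=
  exist is_tableau _ (act_tableau_subproof T g).

Fact act_tabloid_subproof (t : tabloid) (g : 'S_n) :
  is_tabloid [ffun x => val t (g^-1%g x)].
Proof.
apply/forallP=> r; have /forallP/(_ r)/eqP <- := valP t.
rewrite -[X in _ == X](card_imset _ (@perm_inj _ g)); apply/eqP/eq_card=> y.
rewrite inE ffunE; apply/eqP/imsetP => [ty | [x + ->]].
  by exists (g^-1%g y); rewrite ?inE ?ty ?permKV.
by rewrite inE permK => /eqP.
Qed.

Definition act_tabloid (t : tabloid) (g : 'S_n) : tabloid :=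
  exist is_tabloid _ (act_tabloid_subproof t g).

Lemma act_tabloid_of (T : tableau) (g : 'S_n) :
  act_tabloid (tabloid_of T) g = tabloid_of (act_tableau T g).
Proof. by apply/val_inj/ffunP=> x; rewrite !ffunE. Qed.

Lemma act_tabloid1 (t : tabloid) : act_tabloid t 1 = t.
Proof. by apply/val_inj/ffunP=> x; rewrite !ffunE invg1 perm1. Qed.

Lemma act_tabloidM (t : tabloid) (g h : 'S_n) :
  act_tabloid t (g * h) = act_tabloid (act_tabloid t g) h.
Proof. by apply/val_inj/ffunP=> x; rewrite !ffunE invMg permM. Qed.

(* [tabloid_prec s t] is {s} <| {t}. *)
Definition tabloid_prec (s t : tabloid) : bool :=
  [exists x : 'I_n, [forall y : 'I_n, (y < x)%N ==> (val s y == val t y)]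
                    && (val s x < val t x)%N].

End Shapes.

(** * Permutation modules, Specht modules, Frobenius characteristic *)

(* A series of bounded degree in x_1, x_2, ... with integer coefficients is
   given by its truncations to x_1, ..., x_N, for all N (Macdonald's inverse
   limit); equality of series is equality of all truncations. *)
Definition series := forall N : nat, {mpoly int[N]}.

Section Specht.
Variables (F : fieldType) (n : nat).

Definition Sn_module (d : nat) := mx_representation F [set: 'S_n] d.

Section OneShape.
Variable la : intpartn n.

Definition tabloid_vec (t : tabloid la) : 'rV[F]_#|{: tabloid la}| :=
  delta_mx 0 (enum_rank t).

Definition perm_module_mx (g : 'S_n) : 'M[F]_#|{: tabloid la}| :=
  \matrix_i tabloid_vec (act_tabloid (enum_val i) g).

Lemma tabloid_vec_act (t : tabloid la) g :
  tabloid_vec t *m perm_module_mx g = tabloid_vec (act_tabloid t g).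
Proof. by rewrite -rowE rowK enum_rankK. Qed.

Fact perm_module_subproof : mx_repr [set: 'S_n] perm_module_mx.
Proof.
split=> [|g h _ _]; apply/row_matrixP=> i.
  by rewrite rowK act_tabloid1 row1 /tabloid_vec enum_valK.
by rewrite row_mul !rowK tabloid_vec_act act_tabloidM.
Qed.

Definition perm_module : Sn_module #|{: tabloid la}| :=
  MxRepresentation perm_module_subproof.

Definition col_stab (T : tableau la) : {set 'S_n} :=
  [set g : 'S_n | [forall x, col_of (val T (g x)) == col_of (val T x)]].

Definition polytabloid (T : tableau la) : 'rV[F]_#|{: tabloid la}| :=
  \sum_(g in col_stab T)
     (-1) ^+ odd_perm g *: tabloid_vec (tabloid_of (act_tableau T g)).

Definition Specht_mx : 'M[F]_#|{: tabloid la}| :=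
  (\sum_(T : tableau la) <<polytabloid T>>)%MS.

Lemma polytabloid_act (T : tableau la) g :
  polytabloid T *m perm_module_mx g = polytabloid (act_tableau T g).
Proof.
rewrite /polytabloid mulmx_suml (reindex_inj (conjg_inj (g^-1)%g)) /=.
apply: eq_big => [h | h _].
  rewrite !inE; apply/forallP/forallP=> hT x.
    by have := hT (g^-1 x)%g; rewrite !ffunE conjgE invgK !permM permKV.
  by have := hT (g x); rewrite !ffunE conjgE invgK !permM permK.
rewrite odd_permJ -scalemxAl tabloid_vec_act act_tabloid_of.
congr (_ *: tabloid_vec _); congr tabloid_of; apply/val_inj/ffunP=> x; rewrite !ffunE; congr (val T _).
by rewrite -!permM conjgE !invMg !invgK -!mulgA mulKg.
Qed.

Lemma Specht_module : mxmodule perm_module Specht_mx.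
Proof.
apply/mxmoduleP=> g _; rewrite sumsmxMr; apply/sumsmx_subP=> T _.
rewrite (eqmxMr _ (genmxE _)) polytabloid_act.
by apply: (sumsmx_sup (act_tableau T g)); rewrite ?genmxE.
Qed.

Definition Specht : Sn_module (\rank Specht_mx) := submod_repr Specht_module.

(* The condition for semistandard fillings does not depend on the French or
   English drawing: rows increase weakly away from the first column, columns
   strictly away from the longest row. *)
Definition semistandard (N : nat) (T : {ffun cell la -> 'I_N}) : bool :=
  [forall c, forall c',
     ((row_of c == row_of c') && (col_of c <= col_of c')%N
        ==> (T c <= T c')%N)
  && ((col_of c == col_of c') && (row_of c < row_of c')%N
        ==> (T c < T c')%N)].

Definition Schur_function : series := fun N =>
  \sum_(T : {ffun cell la -> 'I_N} | semistandard T) \prod_c 'X_(T c).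

End OneShape.

(* F_char(M) = f. In characteristic 0, M is isomorphic to a direct sum of
   Specht modules in exactly one way, so f exists and is unique. *)
Definition Fchar (d : nat) (M : Sn_module d) (f : series) : Prop :=
  exists mus : seq (intpartn n),
    mx_rsim M (\big[dadd_grepr/grepr0]_(mu <- mus) Representation (Specht mu))
    /\ forall N, f N = \sum_(mu <- mus) Schur_function mu N.

End Specht.

(** * Modules over the 0-Hecke algebra, quasisymmetric characteristic *)

Section ZeroHecke.
Variables (F : fieldType) (n : nat).

(* Operators act on row vectors by right multiplication. *)
Definition Hecke0_action (d : nat) (P : 'I_n.-1 -> 'M[F]_d) : Prop :=
  [/\ forall i, P i *m P i = - P i,
      forall i j : 'I_n.-1, (i.+2 <= j)%N || (j.+2 <= i)%N -> P i *m P j = P j *m P i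
    & forall i j : 'I_n.-1, j = i.+1 :> nat ->
        P i *m P j *m P i = P j *m P i *m P j].

Definition Hecke0_simple (I : {set 'I_n.-1}) (i : 'I_n.-1) : 'M[F]_1 :=
  if i \in I then -1 else 0.

Definition Hecke0_stable (d : nat) (P : 'I_n.-1 -> 'M[F]_d) (U : 'M[F]_d) :=
  forall i, (U *m P i <= U)%MS.

(* For submodules V <= U of (F^d, P): the quotient U / V is isomorphic to
   (F^e, Q), i.e. some homomorphism from U onto F^e has kernel V. *)
Definition quotient_iso (d e : nat) (P : 'I_n.-1 -> 'M[F]_d) (U V : 'M[F]_d)
    (Q : 'I_n.-1 -> 'M[F]_e) : Prop :=
  exists f : 'M[F]_(d, e),
    [/\ row_full (U *m f),
        (U :&: kermx f :=: V)%MS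
      & forall i, U *m P i *m f = U *m f *m Q i].

Definition Hecke0_composition_factors (d : nat) (P : 'I_n.-1 -> 'M[F]_d)
    (Is : seq {set 'I_n.-1}) : Prop :=
  exists U : nat -> 'M[F]_d,
    [/\ U 0%N = 0,
        (U (size Is) :=: 1%:M)%MS,
        forall j, (j <= size Is)%N -> Hecke0_stable P (U j)
      & forall j, (j < size Is)%N ->
          (U j <= U j.+1)%MS
          /\ quotient_iso P (U j.+1) (U j) (Hecke0_simple (nth set0 Is j))].

Definition fundamental (I : {set 'I_n.-1}) : series := fun N =>
  \sum_(w : {ffun 'I_n -> 'I_N}
         | [forall j, (w (letter j) <= w (letter_succ j))%N]
           && [forall j in I, (w (letter j) < w (letter_succ j))%N])
    \prod_k 'X_(w k).

(* F^Q_char(N) = f, for N = (F^d, P); f is unique by the Jordan-Hoelder theorem. *)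
Definition FQchar (d : nat) (P : 'I_n.-1 -> 'M[F]_d) (f : series) : Prop :=
  exists Is : seq {set 'I_n.-1},
    Hecke0_composition_factors P Is
    /\ forall N, f N = \sum_(I <- Is) fundamental I N.

End ZeroHecke.

(** * Strong quasisymmetric characteristic compatibility *)

Section SQCC.
Variables (F : fieldType) (n d : nat) (M : Sn_module F n d).
Variables (X : finType) (v : X -> 'rV[F]_d) (le : rel X).

Local Notation lt x y := ((x != y) && le x y).
Local Notation s i := (M (simple_transp i)).

Definition total_order : Prop :=
  [/\ reflexive le, antisymmetric le, transitive le & total le].

Definition basis_family : bool := basis_of fullv (codom v).

Definition coef (w : 'rV[F]_d) (x : X) : F :=
  coord (codom_tuple v) (enum_rank x) w.

(* The junk value 0 is taken only at w = 0. *)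
Definition trailing_term (w : 'rV[F]_d) : 'rV[F]_d :=
  if [pick x | (coef w x != 0) && [forall y, (coef w y != 0) ==> le x y]]
    is Some x then coef w x *: v x else 0.

Definition kills (i : 'I_n.-1) (t : X) : bool :=
  trailing_term (v t *m s i) == v t.

Definition negates (i : 'I_n.-1) (t : X) : bool :=
  [exists j, lt t j && (v t *m s i == v j)] || (v t *m s i == - v t).

Definition lowers (i : 'I_n.-1) (t : X) : bool :=
  [exists j, lt j t && (v t *m s i == v j)].

(* The junk value in the last line is excluded by the second clause of
   [SQCC]. *)
Definition pi_basis (i : 'I_n.-1) (t : X) : 'rV[F]_d :=
  if kills i t then 0
  else if negates i t then - v t
  else if lowers i t then v t *m s i
  else 0.

Definition pi_bar (i : 'I_n.-1) : 'M[F]_d :=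
  lin1_mx (fun w => \sum_t coef w t *: pi_basis i t).

Definition SQCC : Prop :=
  [/\ total_order /\ basis_family,
      forall i t, [|| kills i t, negates i t | lowers i t],
      Hecke0_action pi_bar
    & exists f, FQchar pi_bar f /\ Fchar M f].

End SQCC.

(* Main.v *)
(* The operators send a tabloid [t], read as the word of the rows of its letters,
   to 0, to [- t] or to [s_i t], according to the comparison of the rows of [i]
   and [i + 1]; the spans of the initial segments of [<=] form a composition
   series, in which [t] contributes the factor indexed by the ascents of its word.
   Hence the quasisymmetric characteristic is the sum over the tabloids [t] of
   the fundamental functions of their ascents, whose coefficients count the
   nonnegative integer matrices with given margins.

   The counts of horizontal strips above and below two shapes agree (toggling
   each part in its interval), so removing a strip commutes with adding strips
   up to the evident correction. This yields Cauchy's identity: the number of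
   matrices with margins [la] and [nu] is [sum_mu K_(mu, la) K_(mu, nu)].

   Young's rule then follows from linear algebra. The dimension of the space of
   intertwiners from [M^ka] to [M^la] is the number of orbits of pairs of
   tabloids, i.e. of matrices with margins [ka] and [la], so it is the Gram
   matrix of the Kostka numbers. It is also the Gram matrix of the
   multiplicities of the Specht modules, plus a nonnegative contribution of the
   other constituents. Both arrays are unitriangular for dominance (James's
   lemma for the multiplicities), so they agree and there are no other
   constituents. *)
From HB Require Import structures.
From Stdlib Require Import Classical_Prop.
Require Import Defs.
From mathcomp Require Import all_boot all_order all_algebra all_fingroup.
From mathcomp Require Import all_character.
From mathcomp Require Import mpoly zify.

Set Implicit Arguments.
Unset Strict Implicit.
Unset Printing Implicit Defensive.

Import GRing.Theory.

(** * Horizontal strips and the toggle bijection *)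

(** The Hecke relations only compare the rows of at most four letters; the difficulty is the
    equality of characteristics, where [F] is any field of characteristic 0, not assumed to split
    the group. Multiplicities are therefore replaced with the dimensions m(mu, la) of Hom(S^mu,
    M^la), obtained as ranks of averaging projections and compared through traces; James's argument
    gives End(S^mu) = F directly. The Gram matrices are compared in the mixed form sum_mu K(mu, ka)
    m(mu, la) = sum_mu K(mu, ka) K(mu, la), whose left side supposes M^ka already decomposed. Hence
    the induction descends along a rank that refines dominance, and m(-, la) is known before M^la is
    decomposed. For ka = la, a simple summand W of M^la that is not a Specht module would add dim
    Hom(W, M^la) > 0 to a total that is already exhausted. Shapes are functions in a finite type
    with [n.+1] rows of length at most [n], so that sums over shapes are finite and a partition of
    size at most [n] ends with an empty row. *)

Section BoundedFunctions.
Variables (n m : nat).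
Implicit Types p q : {ffun 'I_m -> 'I_n.+1}.

Definition ext p (i : nat) : nat := oapp (fun j => val (p j)) 0 (insub i).

Definition wt p := \sum_(i < m) p i.

(* Junk at the [i] with [f i > n]. *)
Definition trunc (f : nat -> nat) : {ffun 'I_m -> 'I_n.+1} :=
  [ffun i : 'I_m => inord (f i)].

Lemma ext_ord p (i : 'I_m) : ext p i = p i.
Proof. by rewrite /ext valK. Qed.

Lemma ext_default p i : m <= i -> ext p i = 0.
Proof. by move=> le_mi; rewrite /ext insubF // ltnNge le_mi. Qed.

Lemma wtE p : wt p = \sum_(0 <= i < m) ext p i.
Proof. by rewrite big_mkord; apply: eq_bigr => i _; rewrite ext_ord. Qed.

Lemma ext_le_wt p i : ext p i <= wt p.
Proof.
have [le_mi|lt_im] := leqP m i; first by rewrite ext_default.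
rewrite /wt (bigD1 (Ordinal lt_im)) //= -ext_ord; exact: leq_addr.
Qed.

Lemma ext_inj p q : ext p =1 ext q -> p = q.
Proof. by move=> eq_pq; apply/ffunP=> i; apply/val_inj; rewrite /= -!ext_ord eq_pq. Qed.

Lemma ext_trunc f i : i < m -> f i <= n -> ext (trunc f) i = f i.
Proof.
by move=> lt_im le_fn; rewrite (ext_ord _ (Ordinal lt_im)) ffunE /= inordK.
Qed.

Lemma wt_trunc f : (forall i, i < m -> f i <= n) ->
  wt (trunc f) = \sum_(0 <= i < m) f i.
Proof.
move=> le_fn; rewrite wtE; apply: eq_big_nat => i /andP[_ lt_im].
by rewrite ext_trunc // le_fn.
Qed.

Lemma leq_summand f i : i < m -> f i <= \sum_(0 <= j < m) f j.
Proof. by move=> lt_im; rewrite big_mkord (bigD1 (Ordinal lt_im)) //= leq_addr. Qed.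

End BoundedFunctions.

Section HorizontalStrips.
Variable n : nat.
Local Notation P := {ffun 'I_n.+1 -> 'I_n.+1}.
Implicit Types ka al be nu : P.

(** Horizontal strips as interlacing of parts. Elements of [P] need not be nonincreasing, but
    interlacing forces both shapes to be ([hstrip_anti]). *)
Definition hstrip ka nu : bool :=
  [forall i : 'I_n.+1, ext nu i.+1 <= ext ka i <= ext nu i].

Lemma hstripP ka nu :
  reflect (forall i, ext nu i.+1 <= ext ka i <= ext nu i) (hstrip ka nu).
Proof.
apply: (iffP forallP) => [st i | st i]; last exact: st.
have [le_ni|lt_in] := leqP n.+1 i; last exact: (st (Ordinal lt_in)).
by rewrite !ext_default // leqW.
Qed.

Lemma hstrip_wt ka nu : hstrip ka nu -> wt ka <= wt nu.
Proof.
move/hstripP=> st; apply: leq_sum => i _; rewrite -!ext_ord.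
by case/andP: (st i).
Qed.

Lemma hstrip_anti ka al be : hstrip ka al || hstrip al be ->
  forall i, ext al i.+1 <= ext al i.
Proof.
case/orP=> /hstripP st i; first by case/andP: (st i); apply: leq_trans.
have /andP[le1 _] := st i; have /andP[_ le2] := st i.+1.
exact: leq_trans le2 le1.
Qed.

Lemma nonincreasing_leq (f : nat -> nat) : (forall i, f i.+1 <= f i) ->
  forall i j, i <= j -> f j <= f i.
Proof.
move=> dec i j /subnKC <-; elim: (j - i) => [|d IHd]; first by rewrite addn0.
by rewrite addnS; apply: leq_trans (dec _) IHd.
Qed.

Lemma last_row0 al : (forall i, ext al i.+1 <= ext al i) -> wt al <= n ->
  ext al n = 0.
Proof.
move=> dec le_n; apply/eqP; rewrite -leqn0 leqNgt; apply/negP=> pos.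
have: \sum_(i < n.+1) 1 <= wt al.
  apply: leq_sum => i _; rewrite -ext_ord.
  by apply: leq_trans pos _; apply: (nonincreasing_leq dec); rewrite -ltnS.
by rewrite sum1_card card_ord => /leq_trans/(_ le_n); rewrite ltnn.
Qed.

(* The tableau toggle: the parts of [nu] and [ka] range over the same product
   of intervals up to the reflection of each interval, except for the largest
   part of [nu], which is fixed by the size. *)
Definition toggle_sum al be i :=
  minn (ext al i) (ext be i) + maxn (ext al i.+1) (ext be i.+1).

(** This is the local rule of the Robinson-Schensted-Knuth correspondence. The excess
    [wt ka + a - wt be] of the largest part is the matrix entry of the rule; the inequality in
    [below] says that it is a true difference. *)
Definition toggle_up al be a ka : P := trunc n n.+1 (fun i =>
  if i is i'.+1 then toggle_sum al be i' - ext ka i'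
  else maxn (ext al 0) (ext be 0) + (wt ka + a - wt be)).

Definition toggle_down al be nu : P :=
  trunc n n.+1 (fun i => toggle_sum al be i - ext nu i.+1).

Definition above al be a nu :=
  [&& hstrip al nu, hstrip be nu & wt nu == wt al + a].
Definition below al be a ka :=
  [&& hstrip ka al, hstrip ka be & wt be <= wt ka + a].

Section Toggle.
Variables (al be : P) (a b : nat).
Hypotheses (le_n : wt al + a <= n) (eq_wt : wt be + b = wt al + a).
Hypothesis dec_al : forall i, ext al i.+1 <= ext al i.
Hypothesis dec_be : forall i, ext be i.+1 <= ext be i.

Let al_n : ext al n = 0. Proof. by apply: last_row0 => //; lia. Qed.
Let be_n : ext be n = 0. Proof. by apply: last_row0 => //; lia. Qed.

(** The minimum and the maximum of two parts add up to their sum; [toggle_sum] pairs each minimum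
    with the next maximum, which leaves out the maximum of index 0. *)
Let sum_toggle :
  \sum_(0 <= i < n) toggle_sum al be i + maxn (ext al 0) (ext be 0)
    = wt al + wt be.
Proof.
have -> : wt al + wt be = \sum_(0 <= i < n.+1) (ext al i + ext be i).
  by rewrite !wtE big_split.
have -> : \sum_(0 <= i < n.+1) (ext al i + ext be i) =
  \sum_(0 <= i < n.+1) minn (ext al i) (ext be i) +
  \sum_(0 <= i < n.+1) maxn (ext al i) (ext be i).
  by rewrite -big_split /=; apply: eq_bigr => i _; lia.
rewrite [X in X + _ = _]big_split /= big_nat_recr //= al_n be_n.
by rewrite [X in _ = _ + X]big_nat_recl //=; lia.
Qed.

Lemma toggle_upE ka : below al be a ka ->
  [/\ ext (toggle_up al be a ka) 0
         = maxn (ext al 0) (ext be 0) + (wt ka + a - wt be),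
      forall i, ext (toggle_up al be a ka) i.+1 + ext ka i = toggle_sum al be i
    & wt (toggle_up al be a ka) = wt al + a].
Proof.
case/and3P=> /hstripP st_al /hstripP st_be le_be.
have le_tog i : ext ka i <= toggle_sum al be i.
  by have := st_al i; have := st_be i; rewrite /toggle_sum; lia.
have ka_n : ext ka n = 0 by have := st_al n; lia.
have sum_ka : \sum_(0 <= i < n) ext ka i = wt ka.
  by rewrite wtE big_nat_recr //= ka_n addn0.
have sum_up : \sum_(0 <= i < n.+1) (if i is i'.+1 then toggle_sum al be i' - ext ka i'
  else maxn (ext al 0) (ext be 0) + (wt ka + a - wt be)) = wt al + a.
  rewrite big_nat_recl //=.
  have : \sum_(0 <= i < n) (toggle_sum al be i - ext ka i) + wt ka =
    \sum_(0 <= i < n) toggle_sum al be i.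
    rewrite -sum_ka -big_split /=; apply: eq_bigr => i _; exact: subnK.
  by have := sum_toggle; lia.
have le_up i : i < n.+1 -> (if i is i'.+1 then toggle_sum al be i' - ext ka i'
  else maxn (ext al 0) (ext be 0) + (wt ka + a - wt be)) <= n.
  move=> lt_in; apply: leq_trans le_n; rewrite -sum_up; exact: leq_summand.
split; first by rewrite ext_trunc // (le_up 0).
- move=> i; have [lt_in|le_ni] := ltnP i n.
    by rewrite ext_trunc ?(le_up i.+1) //; apply: subnK.
  have alz j : n <= j -> ext al j = 0.
    by move/(nonincreasing_leq dec_al); lia.
  have bez j : n <= j -> ext be j = 0.
    by move/(nonincreasing_leq dec_be); lia.
  rewrite ext_default // /toggle_sum !alz ?bez //; try lia.
  by have /andP[_] := st_al i; rewrite alz //; lia.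
- by rewrite /toggle_up wt_trunc.
Qed.

Lemma toggle_downE nu : above al be a nu ->
  [/\ forall i, ext (toggle_down al be nu) i + ext nu i.+1 = toggle_sum al be i
    & wt (toggle_down al be nu) + maxn (ext al 0) (ext be 0) + a
        = wt be + ext nu 0].
Proof.
case/and3P=> /hstripP st_al /hstripP st_be /eqP wt_nu.
have le_tog i : ext nu i.+1 <= toggle_sum al be i.
  by have := st_al i; have := st_be i; rewrite /toggle_sum; lia.
have nu_n : ext nu n.+1 = 0 by exact: ext_default.
have sum_down : \sum_(0 <= i < n.+1) (toggle_sum al be i - ext nu i.+1)
    + maxn (ext al 0) (ext be 0) + a = wt be + ext nu 0.
  have : \sum_(0 <= i < n) (toggle_sum al be i - ext nu i.+1) + (wt nu - ext nu 0) =
    \sum_(0 <= i < n) toggle_sum al be i.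
    have -> : wt nu - ext nu 0 = \sum_(0 <= i < n) ext nu i.+1.
      by rewrite wtE big_nat_recl //=; lia.
    by rewrite -big_split /=; apply: eq_bigr => i _; exact: subnK.
  have tog_n : toggle_sum al be n = 0.
    by rewrite /toggle_sum !al_n !be_n !ext_default.
  rewrite big_nat_recr //= tog_n.
  by have := sum_toggle; have := ext_le_wt nu 0; lia.
have le_down i : toggle_sum al be i - ext nu i.+1 <= n.
  by have := st_al i.+1; have := st_be i.+1; have := ext_le_wt al i; rewrite /toggle_sum; lia.
split; last by rewrite /toggle_down wt_trunc.
move=> i; have [lt_in|le_ni] := ltnP i n.+1.
  by rewrite ext_trunc ?le_down //; apply: subnK.
by rewrite /toggle_sum !ext_default //; lia.
Qed.

Lemma toggle_upP ka : below al be a ka -> above al be a (toggle_up al be a ka).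
Proof.
move=> lo; have [up0 upS wt_up] := toggle_upE lo.
case/and3P: lo => /hstripP st_al /hstripP st_be _.
apply/and3P; split; last exact/eqP; apply/hstripP=> i.
  have:= upS i; have := st_al i; have := st_be i; rewrite /toggle_sum.
  case: i => [|i]; first by rewrite up0; lia.
  by have := upS i; have := st_al i; have := st_be i; rewrite /toggle_sum; lia.
have:= upS i; have := st_al i; have := st_be i; rewrite /toggle_sum.
case: i => [|i]; first by rewrite up0; lia.
by have := upS i; have := st_al i; have := st_be i; rewrite /toggle_sum; lia.
Qed.

Lemma toggle_downP nu : above al be a nu -> below al be a (toggle_down al be nu).
Proof.
move=> hi; have [down wt_down] := toggle_downE hi.
case/and3P: hi => /hstripP st_al /hstripP st_be _.
apply/and3P; split; last by have := st_al 0; have := st_be 0; lia.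
  apply/hstripP=> i; have := down i; have := st_al i; have := st_be i.
  by have := st_al i.+1; have := st_be i.+1; rewrite /toggle_sum; lia.
apply/hstripP=> i; have := down i; have := st_al i; have := st_be i.
by have := st_al i.+1; have := st_be i.+1; rewrite /toggle_sum; lia.
Qed.

Lemma toggle_upK ka : below al be a ka ->
  toggle_down al be (toggle_up al be a ka) = ka.
Proof.
move=> lo; have [_ upS _] := toggle_upE lo.
have [down _] := toggle_downE (toggle_upP lo).
by apply: ext_inj => i; have := upS i; have := down i; lia.
Qed.

Lemma toggle_downK nu : above al be a nu ->
  toggle_up al be a (toggle_down al be nu) = nu.
Proof.
move=> hi; have [down wt_down] := toggle_downE hi.
have [up0 upS _] := toggle_upE (toggle_downP hi).
case/and3P: hi => /hstripP st_al /hstripP st_be _.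
apply: ext_inj => -[|i]; last by have := upS i; have := down i; lia.
by have := st_al 0; have := st_be 0; rewrite up0; lia.
Qed.

End Toggle.

Lemma card_above_below al be a b : wt al + a <= n -> wt be + b = wt al + a ->
  #|[pred nu | above al be a nu]| = #|[pred ka | below al be a ka]|.
Proof.
move=> le_n eq_wt.
(* If [al] or [be] is not nonincreasing, no strip starts or ends there and both sets are empty. *)
have [dec|ndec] := boolP [forall i : 'I_n.+1, (ext al i.+1 <= ext al i)
                           && (ext be i.+1 <= ext be i)]; last first.
  rewrite !eq_card0 //.
    move=> ka; rewrite !inE; apply/negbTE/negP=> /and3P[st1 st2 _].
    case/negP: ndec; apply/forallP=> i.
    by rewrite (@hstrip_anti ka al ka) ?(@hstrip_anti ka be ka) ?st1 ?st2.
  move=> nu; rewrite !inE; apply/negbTE/negP=> /and3P[st1 st2 _].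
  case/negP: ndec; apply/forallP=> i.
  by rewrite (@hstrip_anti nu al nu) ?(@hstrip_anti nu be nu) ?st1 ?st2 ?orbT.
have dec_ (f : P) : f \in [:: al; be] -> forall i, ext f i.+1 <= ext f i.
  move=> f_in i; have [le_ni|lt_in] := leqP n.+1 i.
    by rewrite !ext_default // leqW.
  have /andP[dal dbe] := forallP dec (Ordinal lt_in).
  by move: f_in; rewrite !inE => /orP[]/eqP->.
have [dec_al dec_be] : (forall i, ext al i.+1 <= ext al i) /\
  (forall i, ext be i.+1 <= ext be i) by split; apply: dec_; rewrite !inE eqxx ?orbT.
rewrite -!sum1_card.
rewrite (reindex_onto (toggle_up al be a) (toggle_down al be)) => [|nu hi]; last first.
  exact: (toggle_downK le_n eq_wt).
apply: eq_bigl => ka; rewrite !inE; apply/andP/idP=> [[hi /eqP eq_ka]|lo].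
  by rewrite -eq_ka (toggle_downP le_n eq_wt).
by rewrite (toggle_upP le_n eq_wt) // (toggle_upK le_n eq_wt).
Qed.

End HorizontalStrips.

(** * Chains of shapes, Kostka numbers and Cauchy's identity *)

Section SnocFunctions.
Variables (T : finType) (N : nat).
Implicit Types (f : {ffun 'I_N -> T}) (x : T).

Definition frcons f x : {ffun 'I_N.+1 -> T} :=
  [ffun i : 'I_N.+1 => oapp f x (insub (val i))].

Lemma frcons_ord f x (j : 'I_N) (i : 'I_N.+1) : i = j :> nat -> frcons f x i = f j.
Proof. by move=> eq_ij; rewrite ffunE /= eq_ij valK. Qed.

Lemma frcons_last f x (i : 'I_N.+1) : i = N :> nat -> frcons f x i = x.
Proof. by move=> eq_iN; rewrite ffunE /= insubF // eq_iN ltnn. Qed.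

Lemma frcons_inj f x f' x' : frcons f x = frcons f' x' -> f = f' /\ x = x'.
Proof.
move=> /ffunP eq_f; split; last by have := eq_f ord_max; rewrite !frcons_last.
by apply/ffunP=> i; have := eq_f (widen_ord (leqnSn N) i); rewrite !(@frcons_ord _ _ i).
Qed.

Lemma frconsK (f : {ffun 'I_N.+1 -> T}) :
  frcons [ffun i => f (widen_ord (leqnSn N) i)] (f ord_max) = f.
Proof.
apply/ffunP=> i; have [lt_iN|] := ltnP i N.
  by rewrite (@frcons_ord _ _ (Ordinal lt_iN)) // ffunE; congr (f _); apply: val_inj.
move=> le_Ni; rewrite frcons_last; last by have := ltn_ord i; lia.
by congr (f _); apply: val_inj; have := ltn_ord i; rewrite /=; lia.
Qed.

Lemma big_frcons (R : Type) (idx : R) (op : Monoid.com_law idx)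
    (F : {ffun 'I_N.+1 -> T} -> R) :
  \big[op/idx]_f F f = \big[op/idx]_x \big[op/idx]_f F (frcons f x).
Proof.
rewrite pair_big /=.
rewrite (reindex (fun p : T * {ffun 'I_N -> T} => frcons p.2 p.1)) //=.
exists (fun f : {ffun 'I_N.+1 -> T} =>
         (f ord_max, [ffun i => f (widen_ord (leqnSn N) i)])) => [[x f] _ | f _] /=.
  have [-> ->] := frcons_inj (frconsK (frcons f x)); by [].
exact: frconsK.
Qed.

End SnocFunctions.

Section Chains.
Variables (S : finType) (R : rel S) (size_of : S -> nat) (bot : S).
Implicit Types (s : nat -> nat) (x y : S).

Definition step y x (a : nat) : bool := R y x && (size_of x == size_of y + a).

(** Two instances are used. With [hstrip] a chain is a semistandard tableau, one strip for each
    letter; with [lefun] it is an integer matrix, given by the partial sums of its columns. *)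
Fixpoint nchains s l x : nat :=
  if l is l'.+1 then \sum_(y | step y x (s l')) nchains s l' y else x == bot.

Lemma eq_nchains s s' l x : (forall i, i < l -> s i = s' i) ->
  nchains s l x = nchains s' l x.
Proof.
elim: l x => //= l IHl x eq_s; rewrite eq_s //; apply: eq_bigr => y _.
by apply: IHl => i lt_il; apply: eq_s; apply: leqW.
Qed.

Definition is_chain s l x (c : nat -> S) : bool :=
  [&& c 0 == bot, c l == x & all (fun i => step (c i) (c i.+1) (s i)) (iota 0 l)].

Lemma is_chainP s l x c :
  reflect [/\ c 0 = bot, c l = x & forall i, i < l -> step (c i) (c i.+1) (s i)]
          (is_chain s l x c).
Proof.
apply: (iffP and3P) => [[/eqP-> /eqP-> /allP st]|[-> -> st]]; split=> //.
  by move=> i lt_il; apply: st; rewrite mem_iota.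
by apply/allP=> i; rewrite mem_iota => /st.
Qed.

Lemma is_chainS s l x c :
  is_chain s l.+1 x c = (c l.+1 == x) && step (c l) x (s l) && is_chain s l (c l) c.
Proof.
apply/is_chainP/idP=> [[c0 <- st]|].
  rewrite eqxx st //=; apply/is_chainP; split=> // i lt_il; exact/st/ltnW.
case/andP=> /andP[/eqP <- st] /is_chainP[c0 _ sti]; split=> // i.
by rewrite ltnS leq_eqVlt => /predU1P[->|/sti].
Qed.

Definition nat_fun l (c : {ffun 'I_l.+1 -> S}) (i : nat) : S := c (inord i).

Definition chains s l x : {set {ffun 'I_l.+1 -> S}} :=
  [set c | is_chain s l x (nat_fun c)].

Lemma eq_is_chain s l x c c' : (forall i, i <= l -> c i = c' i) ->
  is_chain s l x c = is_chain s l x c'.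
Proof.
move=> eq_c; rewrite /is_chain !eq_c //; congr [&& _, _ & _].
apply: eq_in_all => i; rewrite mem_iota /= => lt_il.
by rewrite !eq_c // ltnW.
Qed.

Lemma card_chains s l x : #|chains s l x| = nchains s l x.
Proof.
elim: l x => [|l IHl] x /=.
  rewrite -sum1dep_card big_mkcond big_frcons /=.
  rewrite (bigD1 x) //= [X in _ + X]big1 ?addn0 => [|y /negbTE y'x]; last first.
    rewrite big1 // => f _; rewrite /is_chain /nat_fun /= frcons_last ?inordK //.
    by rewrite y'x !andbF.
  rewrite (big_pred1 [ffun _ => x]); last first.
    by move=> f; apply/esym/eqP/ffunP; case.
  by rewrite /is_chain /nat_fun /= frcons_last ?inordK // eqxx andbT; case: (_ == _).
rewrite -sum1dep_card big_mkcond big_frcons /=.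
have nat_l f y i : i <= l -> nat_fun (frcons f y : {ffun 'I_l.+2 -> S}) i = nat_fun f i.
  move=> le_il; rewrite /nat_fun (@frcons_ord _ _ _ _ (inord i)) //.
  by rewrite !inordK ?ltnS // leqW.
have nat_last f y : nat_fun (frcons f y : {ffun 'I_l.+2 -> S}) l.+1 = y.
  by rewrite /nat_fun frcons_last // inordK.
rewrite (bigD1 x) //= [X in _ + X]big1 ?addn0 => [|y /negbTE y'x]; last first.
  by rewrite big1 // => f _; rewrite is_chainS nat_last y'x.
under eq_bigr => f _.
  rewrite is_chainS nat_last eqxx /= nat_l // (eq_is_chain _ _ (c' := nat_fun f)).
    over.
  by move=> i; apply: nat_l.
rewrite -big_mkcond /= (partition_big (fun f : {ffun 'I_l.+1 -> S} => nat_fun f l)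
  (fun y => step y x (s l))) /=; last by move=> f /andP[].
apply: eq_bigr => y st; rewrite -IHl -sum1dep_card; apply: eq_bigl => f.
apply/andP/idP=> [[/andP[_ +] /eqP <-] // | ch].
by have /is_chainP[_ eq_y _] := ch; rewrite !eq_y st ch eqxx.
Qed.

End Chains.

Section Kostka.
Variable n : nat.
Local Notation P := {ffun 'I_n.+1 -> 'I_n.+1}.
Implicit Types (ka al be mu : P) (s : nat -> nat).

Definition zerof m : {ffun 'I_m -> 'I_n.+1} := [ffun=> ord0].

Lemma ext_zerof m i : ext (zerof m) i = 0.
Proof. by rewrite /ext; case: insubP => //= j _ _; rewrite ffunE. Qed.

Lemma wt_zerof m : wt (zerof m) = 0.
Proof. by rewrite wtE big1 // => i _; rewrite ext_zerof. Qed.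

Lemma wt_eq0 m (p : {ffun 'I_m -> 'I_n.+1}) : (wt p == 0) = (p == zerof m).
Proof.
apply/eqP/eqP=> [p0|->]; last exact: wt_zerof.
apply: ext_inj => i; rewrite ext_zerof; apply/eqP; rewrite -leqn0 -p0.
exact: ext_le_wt.
Qed.

Definition Kostka s l mu := nchains (@hstrip n) (@wt _ _) (zerof _) s l mu.

Arguments Kostka : simpl never.

Definition lefun m : rel {ffun 'I_m -> 'I_n.+1} :=
  fun p q => [forall i, p i <= q i].

Lemma lefun_wt m (p q : {ffun 'I_m -> 'I_n.+1}) : lefun p q -> wt p <= wt q.
Proof. by move/forallP=> le_pq; apply: leq_sum => i _. Qed.

Lemma ext_frcons m (p : {ffun 'I_m -> 'I_n.+1}) k i : i < m ->
  ext (frcons p k) i = ext p i.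
Proof.
move=> lt_im; rewrite (ext_ord _ (Ordinal lt_im)).
by rewrite (ext_ord _ (Ordinal (leqW lt_im))) (@frcons_ord _ _ _ _ (Ordinal lt_im)).
Qed.

Lemma ext_frcons_last m (p : {ffun 'I_m -> 'I_n.+1}) k : ext (frcons p k) m = k.
Proof. by rewrite (ext_ord _ (@ord_max m)) frcons_last. Qed.

Lemma wt_frcons m (p : {ffun 'I_m -> 'I_n.+1}) k : wt (frcons p k) = wt p + k.
Proof.
rewrite !wtE big_nat_recr //= ext_frcons_last; congr (_ + _).
by apply: eq_big_nat => i /andP[_ lt_im]; apply: ext_frcons.
Qed.

Lemma lefun_frcons m (p q : {ffun 'I_m -> 'I_n.+1}) k b :
  lefun (frcons p k) (frcons q b) = (k <= b) && lefun p q.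
Proof.
apply/forallP/andP=> [le_pq|[le_kb /forallP le_pq] i].
  split; first by have := le_pq ord_max; rewrite !frcons_last.
  apply/forallP=> i; have := le_pq (widen_ord (leqnSn m) i).
  by rewrite !(@frcons_ord _ _ _ _ i).
have [lt_im|le_mi] := ltnP i m.
  by rewrite !(@frcons_ord _ _ _ _ (Ordinal lt_im)).
have im : i = m :> nat by have := ltn_ord i; lia.
by rewrite !frcons_last.
Qed.

Lemma Kostka_frcons m (p : {ffun 'I_m -> 'I_n.+1}) k mu :
  Kostka (ext (frcons p k)) m.+1 mu
    = \sum_(ka | hstrip ka mu && (wt mu == wt ka + k)) Kostka (ext p) m ka.
Proof.
rewrite /Kostka /= /step ext_frcons_last; apply: eq_bigr => ka _.
by apply: eq_nchains => i lt_im; apply: ext_frcons.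
Qed.

(* The commutation of removing a horizontal strip with the successive additions
   of horizontal strips counted by [Kostka]. *)
Lemma Kostka_remove m (p : {ffun 'I_m -> 'I_n.+1}) a ka : wt ka + a <= n ->
  \sum_(mu | hstrip ka mu && (wt mu == wt ka + a)) Kostka (ext p) m mu
    = \sum_(q | lefun q p && (wt p == wt q + a)) Kostka (ext q) m ka.
Proof.
elim: m p a ka => [|m IHm] p a ka le_n.
  rewrite /Kostka /=.
  have wt0 (q : {ffun 'I_0 -> 'I_n.+1}) : wt q = 0 by rewrite /wt big_ord0.
  rewrite [RHS]big_mkcond (big_pred1 p) => [|q]; last by apply/esym/eqP/ffunP; case.
  have -> : lefun p p by apply/forallP; case.
  rewrite !wt0 add0n big_mkcond (bigD1 (zerof _)) //= big1 => [|mu /negbTE->]; last first.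
    by rewrite if_same.
  rewrite wt_zerof eqxx addn0 [0 == _]eq_sym addn_eq0 wt_eq0 [0 == a]eq_sym.
  have [->|_] := eqVneq ka; last by rewrite andbF if_same.
  have -> : hstrip (zerof n.+1) (zerof n.+1) by apply/hstripP=> i; rewrite !ext_zerof.
  by [].
rewrite -[p]frconsK; set p' := [ffun i => _]; set b := p ord_max.
under eq_bigr do rewrite Kostka_frcons.
rewrite (exchange_big_dep predT) //=.
pose K be := Kostka (ext p') m be.
(* For fixed [be], the summand is independent of [mu], and the [mu] above [ka] and [be] are as many
   as the [ga] below them. *)
transitivity (\sum_be (if wt be + b == wt ka + a then
    \sum_(ga | below ka be a ga) K be else 0)).
  apply: eq_bigr => be _; rewrite sum_nat_const.
  have [/eqP eq_wt | ne_wt] := boolP (_ == _).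
    rewrite sum_nat_const -(card_above_below le_n eq_wt); congr (_ * _).
    apply: eq_card => mu; rewrite !inE /above.
    rewrite unfold_in /= -eq_wt /step; case: (hstrip ka mu); case: (wt mu == _); by rewrite ?andbF ?andbT /=.
  rewrite eq_card0 // => mu; rewrite !inE; apply/negbTE/negP.
  by case/andP=> /andP[_ /eqP->] /andP[_]; rewrite eq_sym (negbTE ne_wt).
rewrite -big_mkcond (exchange_big_dep (fun ga => hstrip ga ka)) /=; last first.
  by move=> be ga _ /and3P[].
rewrite [RHS]big_mkcond big_frcons /=.
transitivity (\sum_(ga | hstrip ga ka) \sum_(k : 'I_n.+1) \sum_(q | [&& k <= b,
    lefun q p', wt p' + b == wt q + k + a & wt ka == wt ga + k]) Kostka (ext q) m ga);
  last first.
  under [RHS]eq_bigr do rewrite -big_mkcond.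
  rewrite exchange_big /=; apply: eq_bigr => k _.
  rewrite (exchange_big_dep (fun q => lefun (frcons q k) (frcons p' b)
      && (wt (frcons p' b) == wt (frcons q k) + a))) /=; last first.
    by move=> ga q _; rewrite lefun_frcons !wt_frcons => /and4P[-> -> -> _].
  apply: eq_bigr => q; rewrite lefun_frcons !wt_frcons => /andP[/andP[le_kb le_qp] eq_wt].
  by rewrite Kostka_frcons; apply: eq_bigl => ga; rewrite le_kb le_qp eq_wt.
apply: eq_bigr => ga st; have le_ga := hstrip_wt st.
(* The last entry of [q] is forced to be [k0]. Since [wt be + b = wt ka + a], the inequality in
   [below] reads [k0 <= b], which is the last condition of [lefun]. *)
set k0 := wt ka - wt ga.
have [le_kb|lt_bk] := leqP k0 b; last first.
  rewrite big1 => [|be]; last by case/andP=> /eqP eq_wt /and3P[_ _]; lia.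
  rewrite big1 // => k _; rewrite big1 // => q /and4P[le_kb _ _ /eqP].
  by lia.
have lt_kn : k0 < n.+1 by rewrite /k0; lia.
rewrite (bigD1 (Ordinal lt_kn)) //= [X in _ = _ + X]big1 => [|k ne_k]; last first.
  apply: big1 => q /and4P[_ _ _ /eqP eq_k]; case/eqP: ne_k; apply: val_inj.
  by rewrite /= /k0 eq_k addKn.
rewrite addn0; have [le_b|lt_b] := leqP b (k0 + a); last first.
  rewrite big1 => [|be]; last first.
    by case/andP=> /eqP eq_wt /and3P[_ /hstrip_wt]; lia.
  by rewrite big1 // => q /and4P[_ /lefun_wt le_q /eqP]; lia.
have -> : \sum_(q | [&& k0 <= b, lefun q p', wt p' + b == wt q + k0 + a
    & wt ka == wt ga + k0]) Kostka (ext q) m ga =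
  \sum_(q | lefun q p' && (wt p' == wt q + (k0 + a - b))) Kostka (ext q) m ga.
  apply: eq_bigl => q; rewrite le_kb; case: (lefun _ _) => //=.
  by apply/andP/eqP=> [[/eqP] | ]; [lia | split; apply/eqP; lia].
rewrite -IHm; last by lia.
apply: eq_bigl => be; rewrite /below st; case st2: (hstrip ga be); last by rewrite andbF.
have := hstrip_wt st2 => le_be.
by apply/andP/eqP=> [[/eqP] | ]; [lia | split; [apply/eqP|]; lia].
Qed.

End Kostka.

Lemma nchains_size (S : finType) (R : rel S) (size_of : S -> nat) bot s l x :
  size_of bot = 0 -> nchains R size_of bot s l x != 0 ->
  size_of x = \sum_(0 <= i < l) s i.
Proof.
move=> bot0; elim: l x => [|l IHl] x /=.
  by rewrite big_geq // eqb0 negbK => /eqP->.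
rewrite sum_nat_eq0 negb_forall => /existsP[y]; rewrite negb_imply.
by case/andP=> /andP[_ /eqP->] /IHl ->; rewrite big_nat_recr.
Qed.

Section KostkaCauchy.
Variable n : nat.
Local Notation P := {ffun 'I_n.+1 -> 'I_n.+1}.
Implicit Types (ka mu : P) (s : nat -> nat).
Local Notation Kostka := (@Kostka n).

Lemma Kostka_size s l mu : Kostka s l mu != 0 ->
  wt mu = \sum_(0 <= i < l) s i.
Proof. by apply: nchains_size; apply: wt_zerof. Qed.

Lemma Kostka_zerof m (p : {ffun 'I_m -> 'I_n.+1}) :
  Kostka (ext p) m (zerof n _) = (p == zerof n _).
Proof.
have [->|ne0] := eqVneq p (zerof n m); last first.
  apply/eqP; apply: contraNT ne0 => nz; rewrite -wt_eq0.
  by have := Kostka_size nz; rewrite -wtE wt_zerof => <-.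
rewrite /Kostka; elim: m {p} => [|m IHm] /=; first by rewrite eqxx.
rewrite ext_zerof (bigD1 (zerof n n.+1)) /=; last first.
  rewrite /step addn0 eqxx andbT; apply/hstripP=> i; by rewrite !ext_zerof.
rewrite big1 ?addn0 => [|mu]; last first.
  by rewrite /step wt_zerof addn0 [0 == _]eq_sym wt_eq0 => /andP[/andP[_ ->]].
by rewrite -[RHS]IHm; apply: eq_nchains => i _; rewrite !ext_zerof.
Qed.

(** Induction on [l]: the last strip of the first tableau, once passed through the second by
    [Kostka_remove], becomes a vector of sum [s l] taken off [p], i.e. the last column of the
    matrix. The bound by [n] keeps all shapes inside [P]. *)
Lemma Kostka_Cauchy s l m (p : {ffun 'I_m -> 'I_n.+1}) :
  \sum_(0 <= i < l) s i <= n ->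
  \sum_mu Kostka s l mu * Kostka (ext p) m mu
    = nchains (@lefun n m) (@wt _ _) (zerof n m) s l p.
Proof.
elim: l p => [|l IHl] p le_n.
  rewrite (bigD1 (zerof n _)) //= big1 ?addn0 => [|mu /negbTE ne0]; last first.
    by rewrite /Kostka /= ne0.
  by rewrite Kostka_zerof /Kostka /= eqxx mul1n.
have le_n' : \sum_(0 <= i < l) s i <= n.
  by apply: leq_trans le_n; rewrite big_nat_recr //= leq_addr.
rewrite [RHS]/=; under [RHS]eq_bigr do rewrite -IHl //.
rewrite [RHS]exchange_big /=.
transitivity (\sum_mu \sum_ka (if hstrip ka mu && (wt mu == wt ka + s l)
  then Kostka s l ka * Kostka (ext p) m mu else 0)).
  apply: eq_bigr => mu _; rewrite -big_mkcond -big_distrl; congr (_ * _).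
rewrite exchange_big; apply: eq_bigr => ka _; rewrite -big_distrr /=.
rewrite -big_mkcond -big_distrr /=.
(* The size of [ka], on which the bound in [Kostka_remove] depends, is known only if some chain ends
   at [ka]. *)
have [->|nz] := eqVneq (Kostka s l ka) 0; first by rewrite !mul0n.
congr (_ * _); apply: Kostka_remove.
by rewrite (Kostka_size nz); rewrite big_nat_recr in le_n.
Qed.

Lemma Kostka_rows s l mu i : Kostka s l mu != 0 -> l <= i -> ext mu i = 0.
Proof.
rewrite /Kostka; elim: l mu i => [|l IHl] mu i /=.
  by rewrite eqb0 negbK => /eqP-> _; rewrite ext_zerof.
rewrite sum_nat_eq0 negb_forall => /existsP[ka]; rewrite negb_imply.
case/andP=> /andP[/hstripP st _] /IHl ka0; case: i => // i lt_li.
by have := st i; rewrite (ka0 i) //; lia.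
Qed.

Lemma wt_rows l mu : (forall i, l <= i -> ext mu i = 0) ->
  wt mu = \sum_(0 <= i < l) ext mu i.
Proof.
move=> mu0; rewrite wtE; have [le_ln|lt_nl] := leqP l n.+1.
  rewrite (big_cat_nat (leq0n l) le_ln) /=.
  rewrite [X in _ + X]big_nat_cond [X in _ + X]big1 ?addn0 // => i.
  by rewrite andbT => /andP[/mu0].
rewrite [RHS](big_cat_nat (leq0n n.+1) (ltnW lt_nl)) /=.
rewrite [X in _ + X]big_nat_cond [X in _ + X]big1 ?addn0 // => i.
by rewrite andbT => /andP[le_ni _]; rewrite ext_default.
Qed.

(** The first [k] strips together occupy at most the first [k] rows. *)
Lemma Kostka_dominance s l mu k : Kostka s l mu != 0 -> k <= l ->
  \sum_(0 <= i < k) s i <= \sum_(0 <= i < k) ext mu i.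
Proof.
elim: l mu => [|l IHl] mu nz.
  by rewrite leqn0 => /eqP->; rewrite !big_geq.
rewrite leq_eqVlt => /predU1P[->|]; last rewrite ltnS => le_kl.
  by rewrite -(Kostka_size nz) -wt_rows // => i; apply: Kostka_rows nz.
move: nz; rewrite /Kostka /= sum_nat_eq0 negb_forall => /existsP[ka].
rewrite negb_imply => /andP[/andP[/hstripP st _] /IHl/(_ le_kl) dom].
by apply: leq_trans dom _; apply: leq_sum => i _; case/andP: (st i).
Qed.

(** The only chain is that of the shapes [cut k] formed by the first [k] rows: a penultimate shape
    has at most [l] rows, so it lies in [cut l], and it has the same size. *)
Lemma Kostka_diag l mu : (forall i, ext mu i.+1 <= ext mu i) ->
  (forall i, l <= i -> ext mu i = 0) -> Kostka (ext mu) l mu = 1.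
Proof.
move=> dec mu0; pose cut k : P := trunc n n.+1 (fun i => if i < k then ext mu i else 0).
have ext_cut k i : ext (cut k) i = if i < k then ext mu i else 0.
  have [lt_in|le_ni] := ltnP i n.+1; last by rewrite !ext_default ?if_same.
  rewrite ext_trunc //; case: ifP => // _; rewrite (ext_ord _ (Ordinal lt_in)).
  by rewrite -ltnS.
have <- : cut l = mu.
  by apply: ext_inj => i; rewrite ext_cut; case: leqP => // /mu0.
rewrite /Kostka -(@eq_nchains _ _ _ _ (ext mu)); last first.
  by move=> i lt_il; rewrite ext_cut lt_il.
elim: l {mu0} => [|l IHl] /=.
  by rewrite (_ : cut 0 = zerof n _) ?eqxx //; apply: ext_inj => i; rewrite ext_cut ext_zerof.
have wt_cut k : wt (cut k) = \sum_(0 <= i < k) ext mu i.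
  rewrite (@wt_rows k) => [|i le_ki]; last by rewrite ext_cut ltnNge le_ki.
  by apply: eq_big_nat => i /andP[_ lt_ik]; rewrite ext_cut lt_ik.
rewrite (bigD1 (cut l)) /=; last first.
  rewrite /step !wt_cut big_nat_recr //= eqxx andbT; apply/hstripP=> i.
  rewrite !ext_cut !ltnS; have := dec i.
  by case: (ltnP i l); case: (leqP i l); lia.
rewrite IHl big1 // => ka /andP[/andP[/hstripP st _] ne]; apply/eqP; apply: contraNT ne => nz; apply/eqP.
have ka0 i : l <= i -> ext ka i = 0 by apply: Kostka_rows nz.
have le_ka i : ext ka i <= ext (cut l) i.
  rewrite ext_cut; case: ltnP => [lt_il|/ka0->] //.
  by have := st i; rewrite !ext_cut !ltnS lt_il (ltnW lt_il) => /andP[].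
apply: ext_inj => i; apply/eqP; rewrite eqn_leq le_ka /= leqNgt; apply/negP=> lt_i.
have [lt_in|le_ni] := ltnP i n.+1; last by move: lt_i; rewrite !ext_default.
have: wt ka < wt (cut l).
  rewrite /wt (bigD1 (Ordinal lt_in)) //= [X in _ < X](bigD1 (Ordinal lt_in)) //=.
  rewrite -!ext_ord /= -addSn leq_add // leq_sum // => j _.
  by rewrite -!ext_ord.
by rewrite (Kostka_size nz) wt_cut ltnn.
Qed.

End KostkaCauchy.

(** * Partitions as a finite type *)

Section PartitionShapes.
Variable n : nat.
Implicit Types la mu : intpartn n.
Local Notation P := {ffun 'I_n.+1 -> 'I_n.+1}.

HB.instance Definition _ := [isSub for @parts n].

Definition pshape la : P := trunc n n.+1 (nth 0 la).

Lemma intpartn_pos la i : i < size la -> 0 < nth 0 la i.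
Proof.
have /and3P[_ /negP la0 _] := partsP la; move/(mem_nth 0) => la_i.
by rewrite lt0n; apply/eqP=> eq0; apply: la0; rewrite -eq0.
Qed.

Lemma intpartn_sum la : \sum_(0 <= i < size la) nth 0 la i = n.
Proof.
by have /and3P[_ _ /eqP sum_la] := partsP la; rewrite -[RHS]sum_la sumnE [RHS](big_nth 0).
Qed.

Lemma intpartn_size la : size la <= n.
Proof.
rewrite -[X in _ <= X](intpartn_sum la) big_mkord -[X in X <= _]card_ord -sum1_card.
by apply: leq_sum => i _; apply: intpartn_pos.
Qed.

Lemma intpartn_anti la i : nth 0 la i.+1 <= nth 0 la i.
Proof.
have /and3P[so _ _] := partsP la.
have [lt_i|le_i] := ltnP i.+1 (size la); last by rewrite nth_default.
by have /(sortedP 0)/(_ i lt_i) := so.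
Qed.

Lemma ext_shape la i : ext (pshape la) i = nth 0 la i.
Proof.
have le_la j : nth 0 la j <= n.
  have [lt_j|le_j] := ltnP j (size la); last by rewrite nth_default.
  rewrite -[X in _ <= X](intpartn_sum la) big_mkord.
  by rewrite (bigD1 (Ordinal lt_j)) //= leq_addr.
have [lt_in|le_ni] := ltnP i n.+1; first by rewrite ext_trunc.
rewrite ext_default // nth_default //; apply: leq_trans le_ni.
exact/leqW/intpartn_size.
Qed.

Lemma wt_shape la : wt (pshape la) = n.
Proof.
rewrite (@wt_rows _ (size la)) => [|i le_i]; last by rewrite ext_shape nth_default.
by under eq_bigr do rewrite ext_shape; apply: intpartn_sum.
Qed.

Definition of_shape (p : P) : option (intpartn n) :=
  insub [seq x <- map (ext p) (iota 0 n.+1) | x != 0].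

Lemma shapeK : pcancel pshape of_shape.
Proof.
move=> la; rewrite /of_shape.
have -> : [seq x <- map (ext (pshape la)) (iota 0 n.+1) | x != 0] = la.
  rewrite (eq_map (ext_shape la)) -(subnKC (leqW (intpartn_size la))) iotaD map_cat.
  rewrite filter_cat add0n [X in _ ++ X](_ : _ = [::]) ?cats0; last first.
    apply/eqP; rewrite -size_eq0 size_filter -leqn0 leqNgt -has_count.
    apply/hasPn=> _ /mapP[i + ->]; rewrite mem_iota => /andP[le_i _].
    by rewrite nth_default.
  rewrite -/(mkseq _ _) mkseq_nth; apply/all_filterP/allP=> x x_la.
  by have /and3P[_ la0 _] := partsP la; apply: contraNneq la0 => <-.
by rewrite valK.
Qed.

HB.instance Definition _ := Finite.copy (intpartn n) (pcan_type shapeK).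

Lemma shape_inj : injective pshape. Proof. exact: pcan_inj shapeK. Qed.

Lemma shape_surj (p : P) : (forall i, ext p i.+1 <= ext p i) -> wt p = n ->
  exists la, pshape la = p.
Proof.
move=> dec wt_p; have ex0 : exists i, ext p i == 0.
  by exists n.+1; rewrite ext_default.
(* [k] is the number of nonzero parts. *)
case: (ex_minnP ex0) => k /eqP pk0 min_k.
have p0 i : k <= i -> ext p i = 0.
  by move/(nonincreasing_leq dec); rewrite pk0 leqn0 => /eqP.
have part : [&& sorted geq (mkseq (ext p) k), 0 \notin mkseq (ext p) k
                & sumn (mkseq (ext p) k) == n].
  apply/and3P; split.
  - by apply/(sortedP 0) => i; rewrite size_mkseq => lt_ik; rewrite !nth_mkseq ?(ltnW lt_ik) //= dec.
  - apply/negP=> /mapP[i]; rewrite mem_iota => /andP[_ lt_ik] /esym/eqP/min_k.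
    by rewrite leqNgt lt_ik.
  - by rewrite sumnE big_map -[X in _ == X]wt_p (wt_rows p0) /index_iota subn0.
exists (IntPartn part); apply: ext_inj => i; rewrite ext_shape /=.
have [lt_ik|le_ki] := ltnP i k; first by rewrite nth_mkseq.
by rewrite nth_default ?size_mkseq // p0.
Qed.

End PartitionShapes.

(** * Integer matrices as classes of words of pairs *)

Section Words.
Variables (n : nat) (Z : finType).
Implicit Types z : {ffun 'I_n -> Z}.

Lemma count_mktuple z (a : pred Z) : count a (mktuple z) = #|[set x | a (z x)]|.
Proof.
rewrite -sum1_count -sum1_card big_map /= big_enum_cond /=.
by apply: eq_bigl => x; rewrite !inE.
Qed.

Lemma perm_mktupleP z z' :
  reflect (forall a, #|[set x | z x == a]| = #|[set x | z' x == a]|)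
          (perm_eq (mktuple z) (mktuple z')).
Proof.
apply: (iffP idP) => [/seq.permP eq_z a | eq_z].
  by rewrite -!(count_mktuple _ (pred1 a)) eq_z.
by apply/allP=> a _; rewrite /= !(count_mktuple _ (pred1 a)) eq_z.
Qed.

Lemma perm_mktuple_act z z' : perm_eq (mktuple z) (mktuple z') ->
  exists g : 'S_n, forall x, z' x = z (g x).
Proof.
rewrite perm_sym => /tuple_permP[g eq_z]; exists g => x.
have := congr1 (fun s : seq Z => nth (z x) s x) eq_z.
rewrite -!tnth_nth !tnth_mktuple.
by [].
Qed.

Lemma word_of_counts (m : Z -> nat) : \sum_a m a = n ->
  exists z, forall a, #|[set x | z x == a]| = m a.
Proof.
move=> sum_m; pose s := flatten [seq nseq (m a) a | a <- enum Z].
have sz_s : size s == n.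
  rewrite size_flatten /shape -map_comp sumnE big_map big_enum /= -sum_m.
  by apply/eqP/eq_bigr => a _; rewrite /= size_nseq.
exists [ffun x => tnth (Tuple sz_s) x] => a.
rewrite -(count_mktuple _ (pred1 a)).
have -> : mktuple [ffun x => tnth (Tuple sz_s) x] = Tuple sz_s :> seq Z.
  congr val; apply: eq_from_tnth => x; by rewrite tnth_mktuple ffunE.
rewrite /= count_flatten -map_comp sumnE big_map big_enum /= (bigD1 a) //=.
by rewrite count_nseq /= eqxx mul1n big1 ?addn0 // => b /negbTE ne_b; rewrite count_nseq /= ne_b.
Qed.

End Words.

Lemma card_partition_by (T Y : finType) (A : {set T}) (f : T -> Y) :
  \sum_y #|[set x in A | f x == y]| = #|A|.
Proof.
rewrite -sum1_card (partition_big f predT) //=.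
by apply: eq_bigr => y _; rewrite -sum1_card; apply: eq_bigl => x; rewrite inE.
Qed.

Section Matrices.
Variables (n N l : nat) (s : nat -> nat) (p : {ffun 'I_N -> 'I_n.+1}).
Implicit Types z : {ffun 'I_n -> 'I_N * 'I_l}.
Local Notation S := {ffun 'I_N -> 'I_n.+1}.

(* Up to permutation of their letters, these words are the integer matrices
   with margins [p] and [s]. *)
Definition biwords : {set {ffun 'I_n -> 'I_N * 'I_l}} :=
  [set z : {ffun 'I_n -> 'I_N * 'I_l} | [forall k : 'I_N, #|[set x | (z x).1 == k]| == p k]
        && [forall r : 'I_l, #|[set x | (z x).2 == r]| == s r]].

(** The sum of the first [i] columns of the matrix of [z], whose entry at [(k, r)] is the number of
    letters [x] with [z x = (k, r)]. The argument of [inord] is at most [n], so no junk occurs. *)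
Definition col_count z (i : nat) : S :=
  [ffun k => inord #|[set x | ((z x).1 == k) && ((z x).2 < i)%N]|].

Definition margin_chain z : {ffun 'I_l.+1 -> S} := [ffun i => col_count z (val i)].

Lemma col_countE z i k :
  col_count z i k = #|[set x | ((z x).1 == k) && ((z x).2 < i)%N]| :> nat.
Proof. by rewrite ffunE inordK // ltnS -[X in _ <= X]card_ord max_card. Qed.

Lemma col_count0 z : col_count z 0 = zerof n N.
Proof.
apply/ffunP=> k; apply: val_inj; rewrite /= col_countE ffunE /=.
by apply: eq_card0 => x; rewrite !inE andbF.
Qed.

Lemma col_countS z i k (lt_il : i < l) :
  col_count z i.+1 k
    = col_count z i k + #|[set x | z x == (k, Ordinal lt_il)]| :> nat.
Proof.
have dis : [set x | ((z x).1 == k) && ((z x).2 < i)%N]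
             :&: [set x | z x == (k, Ordinal lt_il)] = set0.
  apply/setP=> x; rewrite !inE; case: (z x) => a r /=; rewrite xpair_eqE -(val_eqE r) /=.
  by apply/negP=> /andP[/andP[_ lt_ri] /andP[_ /eqP eq_ri]]; lia.
rewrite !col_countE -cardsUI dis cards0 addn0.
apply: eq_card => x; rewrite !inE; case: (z x) => a r /=.
by rewrite xpair_eqE -andb_orr ltnS leq_eqVlt orbC -(val_eqE r).
Qed.

Lemma nat_margin_chain z i : i <= l -> nat_fun (margin_chain z) i = col_count z i.
Proof. by move=> le_il; rewrite /nat_fun ffunE /= inordK. Qed.

Lemma margin_chain_eq z z' : margin_chain z = margin_chain z' ->
  perm_eq (mktuple z) (mktuple z').
Proof.
move=> eq_z; have eq_col i : i <= l -> col_count z i = col_count z' i.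
  by move=> le_il; rewrite -!nat_margin_chain // eq_z.
apply/perm_mktupleP=> -[k [r lt_rl]]; have := col_countS z k lt_rl.
have := col_countS z' k lt_rl; rewrite !eq_col ?(ltnW lt_rl) // => ->.
by move/addnI.
Qed.

Lemma perm_margin_chain z z' : perm_eq (mktuple z) (mktuple z') ->
  margin_chain z = margin_chain z'.
Proof.
move=> /seq.permP eq_z; apply/ffunP=> i; rewrite !ffunE; apply/ffunP=> k; rewrite !ffunE.
congr inord; have := eq_z (fun a => (a.1 == k) && (a.2 < i)%N).
by rewrite !count_mktuple.
Qed.

Hypotheses (sum_s : \sum_(0 <= i < l) s i = n) (wt_p : wt p = n).

(** A chain gives back its matrix by differences of consecutive terms, and [word_of_counts] realizes
    every matrix by a word. *)
Lemma margin_chain_biwords :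
  [set margin_chain z | z in biwords]
    = chains (@lefun n N) (@wt _ _) (zerof n N) s l p.
Proof.
apply/setP=> c; apply/imsetP/idP=> [[z]|].
  rewrite !inE => /andP[/forallP rows /forallP cols] ->{c}.
  apply/is_chainP; split; first by rewrite nat_margin_chain ?col_count0.
    rewrite nat_margin_chain //; apply/ffunP=> k; apply: val_inj.
    rewrite /= col_countE -(eqP (rows k)).
    by apply: eq_card => x; rewrite !inE ltn_ord andbT.
  move=> i lt_il; rewrite !nat_margin_chain // ?(ltnW lt_il) //; apply/andP; split.
    by apply/forallP=> k; rewrite (col_countS _ _ lt_il) leq_addr.
  rewrite -(eqP (cols (Ordinal lt_il))) /wt.
  under eq_bigr do rewrite (col_countS _ _ lt_il).
  rewrite big_split /= eqn_add2l; apply/eqP.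
  rewrite -(card_partition_by [set x | (z x).2 == Ordinal lt_il] (fun x => (z x).1)).
  apply: eq_bigr => k _; apply: eq_card => x; rewrite !inE.
  by case: (z x) => a r; rewrite xpair_eqE andbC.
rewrite inE => /is_chainP[c0 cl st].
(* Column [r] of the matrix is the step from [r] to [r + 1] of the chain; by [le_c] the subtraction
   is never truncated. *)
pose m (a : 'I_N * 'I_l) : nat := nat_fun c a.2.+1 a.1 - nat_fun c a.2 a.1.
have le_c i k : i < l -> nat_fun c i k <= nat_fun c i.+1 k.
  by move=> /st/andP[/forallP].
have sum_r k i : i <= l -> \sum_(r < l | r < i) m (k, r) = nat_fun c i k.
  move=> le_il; rewrite -(big_ord_widen _ (fun r => nat_fun c r.+1 k - nat_fun c r k)) //.
  elim: i le_il => [|i IHi] lt_il; first by rewrite big_ord0 c0 ffunE.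
  by rewrite big_ord_recr /= IHi 1?ltnW // subnKC // le_c.
have sum_k (r : 'I_l) : \sum_k m (k, r) = s r.
  have /andP[_ /eqP] := st r (ltn_ord r); rewrite /wt => wtS.
  apply: (@addnI (\sum_k nat_fun c r k)); rewrite -wtS -big_split /=.
  by apply: eq_bigr => k _; rewrite subnKC // le_c.
have sum_m : \sum_a m a = n.
  rewrite -(pair_bigA _ (fun k r => m (k, r))) exchange_big /=.
  by rewrite (eq_bigr _ (fun r _ => sum_k r)) -[RHS]sum_s big_mkord.
have [z cnt_z] := word_of_counts sum_m; exists z; last first.
  apply/ffunP=> i; have := ltn_ord i; rewrite ltnS => le_il.
  have -> : c i = nat_fun c i by rewrite /nat_fun inord_val.
  rewrite ffunE; apply/ffunP=> k; apply: val_inj.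
  rewrite /= col_countE -(sum_r _ _ le_il) big_mkcond.
  rewrite -(card_partition_by _ (fun x => (z x).2)); apply: eq_bigr => r _.
  rewrite -cnt_z; case: ifP => [lt_ri|ge_ri]; last first.
    apply/esym/eq_card0 => x; rewrite !inE; apply/negP=> /andP[/andP[_ lt_i] /eqP eq_r].
    by rewrite -eq_r lt_i in ge_ri.
  apply: eq_card => x; rewrite !inE; case: (z x) => a r' /=; rewrite xpair_eqE.
  by case: (r' =P r) => [->|]; rewrite ?andbF // lt_ri !andbT.
rewrite inE; apply/andP; split; apply/forallP.
  move=> k; rewrite -cl -(sum_r _ l) // -(card_partition_by _ (fun x => (z x).2)).
  apply/eqP; rewrite [RHS]big_mkcond; apply: eq_bigr => r _; rewrite ltn_ord -cnt_z.
  by apply: eq_card => x; rewrite !inE; case: (z x) => a r'; rewrite xpair_eqE.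
move=> r; rewrite -sum_k -(card_partition_by _ (fun x => (z x).1)).
apply/eqP; apply: eq_bigr => k _; rewrite -cnt_z.
by apply: eq_card => x; rewrite !inE; case: (z x) => a r'; rewrite xpair_eqE andbC.
Qed.

(** Ties in the first component are broken backwards in the second. Thus the word of pairs of [w]
    and [t] is sorted when [w] increases weakly, and strictly at each ascent of [t]: this is the
    condition in [fundamental]. *)
Definition bile : rel ('I_N * 'I_l) :=
  fun a b => (a.1 < b.1)%N || (a.1 == b.1) && (b.2 <= a.2)%N.

Lemma bile_total : total bile.
Proof. by move=> [a r] [b q]; rewrite /bile -!val_eqE /=; lia. Qed.

Lemma bile_trans : transitive bile.
Proof. by move=> [a r] [b q] [c t]; rewrite /bile -!val_eqE /=; lia. Qed.

Lemma bile_anti : antisymmetric bile.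
Proof.
move=> [a r] [b q]; rewrite /bile -!val_eqE /= => le_ab.
by congr (_, _); apply: val_inj => /=; lia.
Qed.

(** Each class of words up to permutation of the letters contains exactly one sorted word, and the
    classes correspond to the chains. *)
Lemma card_sorted_biwords :
  #|[set z in biwords | sorted bile (mktuple z)]|
    = nchains (@lefun n N) (@wt _ _) (zerof n N) s l p.
Proof.
rewrite -card_chains -margin_chain_biwords.
rewrite -(@card_in_imset _ _ margin_chain) => [|z z']; last first.
  rewrite !inE => /andP[_ so] /andP[_ so'] /margin_chain_eq.
  move/(sorted_eq bile_trans bile_anti so so')/val_inj => eq_z.
  by apply/ffunP=> x; have := congr1 (fun t => tnth t x) eq_z; rewrite !tnth_mktuple.
apply: eq_card => c; apply/imsetP/imsetP=> [[z]|[z z_in ->]].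
  by rewrite inE => /andP[z_in _] ->; exists z.
have sz : size (sort bile (mktuple z)) == n by rewrite size_sort size_tuple.
pose z' := [ffun x => tnth (Tuple sz) x].
have tz' : mktuple z' = sort bile (mktuple z) :> seq _.
  by rewrite -[RHS]/(val (Tuple sz)); congr val; apply: eq_from_tnth => x; rewrite tnth_mktuple ffunE.
have pz : perm_eq (mktuple z) (mktuple z') by rewrite tz' perm_sym perm_sort.
exists z'; last exact: perm_margin_chain.
rewrite inE tz' sort_sorted ?andbT; last exact: bile_total.
have [g eq_z] := perm_mktuple_act pz.
move: z_in; rewrite !inE => /andP[/forallP rows /forallP cols].
have card_g (Q : pred _) : #|[set x | Q (z' x)]| = #|[set x | Q (z x)]|.
  rewrite -(card_imset _ (@perm_inj _ g)); apply: eq_card => x.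
  apply/imsetP/idP=> [[y + ->]|]; first by rewrite !inE eq_z.
  by rewrite inE => Qx; exists (g^-1%g x); rewrite ?inE ?eq_z ?permKV.
apply/andP; split; apply/forallP=> k; first by rewrite (card_g (fun a => a.1 == k)).
by rewrite (card_g (fun a => a.2 == k)).
Qed.

End Matrices.

(** * Semistandard tableaux as Gelfand-Tsetlin patterns *)

Section SemistandardTableaux.
Variables (n N : nat) (mu : intpartn n).
Local Notation cell := (cell mu).
Local Notation P := {ffun 'I_n.+1 -> 'I_n.+1}.
Implicit Types (T : {ffun cell -> 'I_N}) (c : cell).

Lemma col_lt c : col_of c < nth 0 mu (row_of c).
Proof. by case: c => r j; apply: ltn_ord. Qed.

Lemma cell_ex r j : j < nth 0 mu r -> exists c : cell, row_of c = r :> nat /\ col_of c = j.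
Proof.
move=> lt_j; have [lt_r|le_r] := ltnP r (size mu); last by rewrite nth_default in lt_j.
exists (Tagged (fun r : 'I_(size mu) => 'I_(nth 0 mu r))
         (Ordinal (lt_j : j < nth 0 mu (Ordinal lt_r)))); by [].
Qed.

Lemma cell_inj c c' : row_of c = row_of c' :> nat -> col_of c = col_of c' -> c = c'.
Proof.
case: c c' => r j [r' j'] /= /val_inj eq_r; rewrite /row_of /= in eq_r.
by subst r'; rewrite /col_of /= => /val_inj ->.
Qed.

Lemma card_row_lt r k :
  #|[set c : cell | (row_of c == r :> nat) && (col_of c < k)]| = minn k (nth 0 mu r).
Proof.
pose f c := inord (col_of c) : 'I_n.+1.
have le_c c : col_of c < n.+1.
  apply: (@leq_trans (ext (pshape mu) (row_of c))); first by rewrite ext_shape col_lt.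
  by apply: leq_trans (ext_le_wt _ _) _; rewrite wt_shape.
rewrite -(@card_in_imset _ _ f) => [|c c']; last first.
  rewrite !inE => /andP[/eqP r_c _] /andP[/eqP r_c' _] /(congr1 val).
  by rewrite /= !inordK // => /cell_inj; apply; rewrite r_c.
have le_k : minn k (nth 0 mu r) <= n.+1.
  rewrite -ext_shape; apply: leq_trans (geq_minr _ _) _; apply: leqW.
  by rewrite -[X in _ <= X](wt_shape mu) ext_le_wt.
have widen_inj : injective (widen_ord le_k).
  by move=> i j /(congr1 val) eq_ij; apply: val_inj.
rewrite -[RHS]card_ord -(card_imset _ widen_inj) /=.
apply: eq_card => j; apply/imsetP/imsetP=> [[c]|[i _ ->]].
  rewrite inE => /andP[/eqP r_c lt_k] ->.
  have lt_c : col_of c < minn k (nth 0 mu r) by rewrite leq_min lt_k -r_c col_lt.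
  by exists (Ordinal lt_c) => //; apply: val_inj; rewrite /= inordK.
have := ltn_ord i; rewrite leq_min => /andP[lt_ik /cell_ex[c [r_c c_c]]].
exists c; first by rewrite inE r_c c_c eqxx.
by apply: val_inj; rewrite /= inordK ?c_c // -c_c.
Qed.

(* The [i]-th step of the Gelfand-Tsetlin pattern of [T] is the shape of the
   cells with entries less than [i]. *)
Definition gt_row T i (r : nat) : nat :=
  #|[set c : cell | (row_of c == r :> nat) && (T c < i)]|.

Definition gt_shape T i : P := trunc n n.+1 (gt_row T i).

Definition gt_chain T : {ffun 'I_N.+1 -> P} := [ffun i => gt_shape T (val i)].

Lemma gt_row_le T i r : gt_row T i r <= nth 0 mu r.
Proof.
rewrite -[X in _ <= X](minn_idPr (leqnSn _)) -card_row_lt; apply: subset_leq_card.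
apply/subsetP=> c; rewrite !inE => /andP[/eqP r_c _]; rewrite -r_c eqxx /=.
exact/ltnW/col_lt.
Qed.

Lemma ext_gt_shape T i r : ext (gt_shape T i) r = gt_row T i r.
Proof.
have [lt_r|le_r] := ltnP r n.+1.
  rewrite ext_trunc //; apply: leq_trans (gt_row_le _ _ _) _.
  by rewrite -ext_shape -[X in _ <= X](wt_shape mu) ext_le_wt.
have := gt_row_le T i r; rewrite ext_default // nth_default ?leqn0 => [/eqP //|].
by apply: leq_trans (intpartn_size mu) (ltnW le_r).
Qed.

Lemma nat_gt_chain T i : i <= N -> nat_fun (gt_chain T) i = gt_shape T i.
Proof. by move=> le_i; rewrite /nat_fun ffunE /= inordK. Qed.

Lemma wt_gt_shape T i : wt (gt_shape T i) = #|[set c | T c < i]|.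
Proof.
have lt_row c : row_of c < n.+1.
  by apply: leq_trans (ltn_ord _) _; apply: leqW; apply: intpartn_size.
rewrite -(card_partition_by _ (fun c => inord (row_of c) : 'I_n.+1)) /wt.
apply: eq_bigr => r _; rewrite -ext_ord ext_gt_shape; apply: eq_card => c.
by rewrite !inE andbC -val_eqE /= inordK.
Qed.

Lemma semistandard_row T c c' : semistandard T -> row_of c = row_of c' :> nat ->
  col_of c <= col_of c' -> T c <= T c'.
Proof.
move=> /forallP/(_ c)/forallP/(_ c')/andP[/implyP ss _] eq_r le_c.
by apply: ss; rewrite le_c andbT; apply/eqP/val_inj.
Qed.

Lemma semistandard_col T c c' : semistandard T -> col_of c = col_of c' ->
  row_of c < row_of c' -> T c < T c'.
Proof.
move=> /forallP/(_ c)/forallP/(_ c')/andP[_ /implyP ss] eq_c lt_r.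
by apply: ss; rewrite eq_c eqxx.
Qed.

(** Rows increase weakly, so the entries less than [i] fill an initial segment of each row. *)
Lemma gt_rowP T i c : semistandard T ->
  (T c < i) = (col_of c < gt_row T i (row_of c)).
Proof.
move=> ss; apply/idP/idP=> [lt_i|].
  suffices <- : #|[set c' : cell | (row_of c' == row_of c :> nat) && (col_of c' < (col_of c).+1)]|
     = (col_of c).+1.
    apply: subset_leq_card; apply/subsetP=> c'; rewrite !inE.
    case/andP=> /eqP eq_r; rewrite ltnS => le_c; rewrite eq_r eqxx /=.
    exact: leq_ltn_trans (semistandard_row ss eq_r le_c) lt_i.
  by rewrite card_row_lt; apply/minn_idPl/col_lt.
apply: contraTT; rewrite -!leqNgt => le_i.
apply: leq_trans (subset_leq_card _)
  (_ : #|[set c' : cell | (row_of c' == row_of c :> nat) && (col_of c' < col_of c)]| <= _).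
  apply/subsetP=> c'; rewrite !inE => /andP[/eqP eq_r lt_i]; rewrite eq_r eqxx /=.
  rewrite ltnNge; apply/negP=> le_c.
  by have := semistandard_row ss (esym eq_r) le_c; rewrite leqNgt (leq_trans lt_i).
by rewrite card_row_lt geq_minl.
Qed.

(** Used to rebuild a tableau from its pattern: [Q i] says that a given cell lies in the [i]-th
    shape, and [t], the last step at which it is absent, is its entry. *)
Lemma threshold (Q : pred nat) : ~~ Q 0 -> Q N ->
  (forall i j, i <= j <= N -> Q i -> Q j) ->
  exists t : 'I_N, forall i, i <= N -> (t < i) = Q i.
Proof.
move=> Q0 QN mono; case: (ex_minnP (ex_intro _ N QN)) => -[|t] Qt min_t.
  by rewrite Qt in Q0.
exists (Ordinal (min_t N QN)) => i le_iN /=; apply/idP/idP=> [lt_ti|/min_t //].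
by apply: mono Qt; rewrite lt_ti.
Qed.

Variable p : {ffun 'I_N -> 'I_n.+1}.

Definition ssyt : {set {ffun cell -> 'I_N}} :=
  [set T | semistandard T && [forall k, #|[set c | T c == k]| == p k]].

Lemma card_ltS T i (lt_i : i < N) :
  #|[set c | T c < i.+1]| = #|[set c | T c < i]| + #|[set c | T c == Ordinal lt_i]|.
Proof.
rewrite -cardsUI [_ :&: _](_ : _ = set0) ?cards0 ?addn0; last first.
  apply/setP=> c; rewrite !inE -val_eqE /=.
  by apply/negP=> /andP[lt1 /eqP eq1]; lia.
by apply: eq_card => c; rewrite !inE -val_eqE /= ltnS leq_eqVlt orbC.
Qed.

Lemma gt_chain_ssyt :
  [set gt_chain T | T in ssyt]
    = chains (@hstrip n) (@wt _ _) (zerof _ _) (ext p) N (pshape mu).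
Proof.
apply/setP=> ch; apply/imsetP/idP=> [[T]|].
  rewrite inE => /andP[ss /forallP cont] ->{ch}; rewrite inE; apply/is_chainP.
  split; rewrite ?nat_gt_chain //.
  - apply: ext_inj => r; rewrite ext_gt_shape ext_zerof.
    by apply: eq_card0 => c; rewrite !inE andbF.
  - apply: ext_inj => r; rewrite ext_gt_shape ext_shape.
    rewrite -[RHS](minn_idPr (leqnSn _)) -card_row_lt; apply: eq_card => c.
    by rewrite !inE ltn_ord; case: eqP => //= <-; rewrite (leqW (col_lt c)).
  move=> i lt_i; rewrite !nat_gt_chain // ?(ltnW lt_i) //; apply/andP; split; last first.
    rewrite !wt_gt_shape (card_ltS _ lt_i) eqn_add2l.
    by rewrite (ext_ord _ (Ordinal lt_i)).
  apply/hstripP=> r; rewrite !ext_gt_shape; apply/andP; split; last first.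
    apply: subset_leq_card; apply/subsetP=> c; rewrite !inE.
    by case/andP=> -> /= /leqW.
  (* If interlacing fails, [c0] and [c1] are the cells of rows [r] and [r.+1] in column
     [gt_row T i r]. Then [T c1 <= i], and strictness of columns gives [T c0 < i], although [c0] is
     outside the cells of its row with entries less than [i]. *)
  rewrite leqNgt; apply/negP=> lt_gt.
  have lt1 := leq_trans lt_gt (gt_row_le _ _ _).
  have lt0 := leq_trans lt1 (intpartn_anti _ _).
  have [c1 [r1 cc1]] := cell_ex lt1; have [c0 [r0 cc0]] := cell_ex lt0.
  have lt_T : T c0 < T c1.
    by apply: semistandard_col => //; rewrite ?cc0 ?cc1 // r0 r1.
  have : T c1 < i.+1 by rewrite gt_rowP // cc1 r1.
  rewrite ltnS => /(leq_trans lt_T); rewrite gt_rowP // cc0 r0.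
  by rewrite ltnn.
rewrite inE => /is_chainP[c0 cN st]; set cf := nat_fun ch in c0 cN st.
have hst i : i < N -> forall r, ext (cf i.+1) r.+1 <= ext (cf i) r <= ext (cf i.+1) r.
  by move=> /st/andP[/hstripP].
have mono i j r : i <= j <= N -> ext (cf i) r <= ext (cf j) r.
  case/andP=> /subnKC <-; elim: (j - i) => [|d IHd]; first by rewrite addn0.
  rewrite addnS => lt_N; apply: leq_trans (IHd (ltnW lt_N)) _.
  by case/andP: (hst _ lt_N r).
have [T TP] : exists T : {ffun cell -> 'I_N}, forall c i, i <= N ->
    (T c < i) = (col_of c < ext (cf i) (row_of c)).
  have ex_t c : exists t : 'I_N, forall i, i <= N ->
      (t < i) = (col_of c < ext (cf i) (row_of c)).
    apply: (@threshold (fun i => col_of c < ext (cf i) (row_of c))).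
    - by rewrite c0 ext_zerof.
    - by rewrite cN ext_shape col_lt.
    - by move=> i j le_ij lt_i; apply: leq_trans lt_i (mono _ _ _ le_ij).
  have [T TP] := fin_all_exists ex_t; exists (finfun T) => c i le_i.
  by rewrite ffunE TP.
have gtE i : i <= N -> gt_shape T i = cf i.
  move=> le_i; apply: ext_inj => r; rewrite ext_gt_shape.
  have le_mu : ext (cf i) r <= nth 0 mu r.
    by rewrite -ext_shape -cN mono // le_i leqnn.
  rewrite -[RHS](minn_idPl le_mu) -card_row_lt; apply: eq_card => c.
  by rewrite !inE TP //; case: eqP => //= ->.
exists T; last first.
  apply/ffunP=> i; rewrite ffunE gtE; last by rewrite -ltnS ltn_ord.
  by rewrite /cf /nat_fun inord_val.
rewrite inE; apply/andP; split; last first.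
  apply/forallP=> k; have := card_ltS T (ltn_ord k).
  rewrite -!wt_gt_shape !gtE ?(ltnW (ltn_ord k)) //.
  have /andP[_ /eqP->] := st k (ltn_ord k); rewrite ext_ord => /addnI ->.
  by apply/eqP; apply: eq_card => c; rewrite !inE; congr (_ == _); apply: val_inj.
apply/forallP=> c; apply/forallP=> c'; apply/andP; split; apply/implyP.
  case/andP=> /eqP eq_r le_c; rewrite leqNgt; apply/negP=> lt_T.
  have le_N : T c <= N by apply: ltnW.
  have := lt_T; rewrite TP // -eq_r => /(leq_ltn_trans le_c).
  by rewrite -TP // ltnn.
case/andP=> /eqP eq_c lt_r; rewrite TP; last exact: ltnW.
have := ltnSn (T c'); rewrite TP // -eq_c => /leq_trans; apply.
have /andP[+ _] := hst _ (ltn_ord (T c')) (row_of c); apply: leq_trans.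
apply: (nonincreasing_leq _ lt_r) => r.
by have /andP[ste _] := st _ (ltn_ord (T c')); apply: (hstrip_anti (ka := cf (T c')) (be := cf 0)); rewrite ste.
Qed.

Lemma card_ssyt : #|ssyt| = Kostka (ext p) N (pshape mu).
Proof.
rewrite /Kostka -card_chains -gt_chain_ssyt card_in_imset // => T T'.
rewrite !inE => /andP[ss _] /andP[ss' _] /ffunP eq_gt; apply/ffunP=> c; apply: val_inj.
have lt_eq i : i <= N -> (T c < i) = (T' c < i).
  move=> le_i; rewrite !gt_rowP // -!ext_gt_shape.
  by have := eq_gt (inord i); rewrite !ffunE /= inordK // => ->.
have le_T : T c <= T' c by rewrite -ltnS lt_eq //; apply: ltnW.
have le_T' : T' c <= T c by rewrite -ltnS -lt_eq //; apply: ltnW.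
by apply/eqP; rewrite eqn_leq le_T le_T'.
Qed.

End SemistandardTableaux.

(** * Monomial expansions of Schur functions and of sums of fundamental functions *)

Section Monomials.
Variables (n N : nat) (X : finType).
Hypothesis card_X : #|X| = n.

Definition content_monomial (p : {ffun 'I_N -> 'I_n.+1}) : {mpoly int[N]} :=
  (\prod_k 'X_k ^+ p k)%R.

Lemma sum_monomials (Q : pred {ffun X -> 'I_N}) :
  (\sum_(w : {ffun X -> 'I_N} | Q w) \prod_x 'X_(w x) =
   \sum_(p | wt p == n) content_monomial p *+
      #|[set w : {ffun X -> 'I_N} | Q w && [forall k, #|[set x | w x == k]| == p k]]|)%R.
Proof.
pose cont (w : {ffun X -> 'I_N}) : {ffun 'I_N -> 'I_n.+1} :=
  [ffun k => inord #|[set x | w x == k]|].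
have contE w k : cont w k = #|[set x | w x == k]| :> nat.
  by rewrite ffunE inordK // ltnS -card_X max_card.
rewrite (partition_big cont (fun p => wt p == n)) => [|w _]; last first.
  rewrite /wt; under eq_bigr do rewrite contE.
  rewrite -[X in _ == X]card_X -cardsT -(card_partition_by setT w); apply/eqP.
  by apply: eq_bigr => k _; apply: eq_card => x; rewrite !inE.
apply: eq_bigr => p _; rewrite -sumr_const; apply: eq_big => w.
  rewrite inE; congr (_ && _); apply/eqP/forallP=> [<- k|eq_p].
    by rewrite contE.
  by apply/ffunP=> k; apply: val_inj; rewrite /= contE (eqP (eq_p k)).
case/andP=> _ /eqP <-; rewrite (partition_big w predT) //=.
apply: eq_bigr => k _; rewrite contE -prodr_const; apply: eq_big => x.
  by rewrite inE.
by move/eqP->.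
Qed.

End Monomials.

Lemma Schur_Kostka n (mu : intpartn n) N :
  (Schur_function mu N = \sum_(p : {ffun 'I_N -> 'I_n.+1} | wt p == n) content_monomial p *+
      Kostka (ext p) N (pshape mu))%R.
Proof.
rewrite /Schur_function (sum_monomials (card_cell mu)).
by apply: eq_bigr => p _; rewrite -card_ssyt.
Qed.

Section Tabloids.
Variables (n : nat) (la : intpartn n).
Implicit Type t : tabloid la.

Definition ascents t : {set 'I_n.-1} :=
  [set j | (val t (letter j) < val t (letter_succ j))%N].

Lemma tabloidP (t : {ffun 'I_n -> 'I_(size la)}) :
  is_tabloid t -> forall r, #|[set x | t x == r]| = nth 0 la r.
Proof. by move=> /forallP tab r; apply/eqP. Qed.

Definition pair_word N (t : {ffun 'I_n -> 'I_(size la)}) (w : {ffun 'I_n -> 'I_N}) :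
  {ffun 'I_n -> 'I_N * 'I_(size la)} := [ffun x => (w x, t x)].

Lemma pair_word_biwords N t w (p : {ffun 'I_N -> 'I_n.+1}) :
  (pair_word (val t) w \in biwords (size la) (nth 0 la) p)
    = [forall k, #|[set x | w x == k]| == p k].
Proof.
rewrite inE [X in _ && X](_ : _ = true) ?andbT; last first.
  apply/forallP=> r; rewrite -(tabloidP (valP t)); apply/eqP/eq_card=> x.
  by rewrite !inE ffunE.
apply: eq_forallb => k; congr (_ == _); apply: eq_card => x.
by rewrite !inE ffunE.
Qed.

Lemma biwords_pair_word N z (p : {ffun 'I_N -> 'I_n.+1}) :
  z \in biwords (size la) (nth 0 la) p ->
  exists t : tabloid la, exists w, z = pair_word (val t) w.
Proof.
rewrite inE => /andP[_ /forallP cols].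
pose t := [ffun x => (z x).2]; have tab : is_tabloid t.
  apply/forallP=> r; rewrite -(eqP (cols r)); apply/eqP/eq_card=> x.
  by rewrite !inE ffunE.
exists (exist (@is_tabloid n la) t tab), [ffun x => (z x).1].
by apply/ffunP=> x; rewrite !ffunE -surjective_pairing.
Qed.

Lemma sorted_mktuple (Z : finType) (r : rel Z) (z : {ffun 'I_n -> Z}) :
  sorted r (mktuple z) = [forall j, r (z (letter j)) (z (letter_succ j))].
Proof.
have nth_z z0 i (lt_i : i < n) : nth z0 (mktuple z) i = z (Ordinal lt_i).
  by rewrite -(tnth_nth _ _ (Ordinal lt_i)) tnth_mktuple.
have lt_succ (j : 'I_n.-1) : j.+1 < n by rewrite -ltn_predRL.
apply/idP/forallP=> [so j|r_z].
  have /(sortedP (z (letter j)))/(_ j) := so; rewrite size_tuple => /(_ (lt_succ j)).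
  rewrite (nth_z _ _ (ltnW (lt_succ j))) (nth_z _ _ (lt_succ j)).
  by congr (is_true (r (z _) (z _))); apply: val_inj.
case: (posnP n) => [n0|n_gt0].
  by rewrite (size0nil (_ : size (mktuple z) = 0)) // size_tuple.
apply/(sortedP (z (Ordinal n_gt0))) => i; rewrite size_tuple => lt_i.
have lt_i' : i < n.-1 by rewrite ltn_predRL.
rewrite (nth_z _ _ (ltnW lt_i)) (nth_z _ _ lt_i).
have := r_z (Ordinal lt_i').
by congr (is_true (r (z _) (z _))); apply: val_inj.
Qed.

Lemma sorted_pair_word N t (w : {ffun 'I_n -> 'I_N}) :
  sorted (@bile _ _) (mktuple (pair_word (val t) w))
    = [forall j, (w (letter j) <= w (letter_succ j))%N]
      && [forall j in ascents t, (w (letter j) < w (letter_succ j))%N].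
Proof.
rewrite sorted_mktuple; apply/forallP/andP=> [so|[/forallP le_w /forallP lt_w] j].
  split; apply/forallP=> j; have := so j; rewrite /bile !ffunE -val_eqE /=.
    by lia.
  rewrite inE => le_j; apply/implyP=> lt_t; case/orP: le_j => // /andP[_].
  by rewrite leqNgt lt_t.
have := le_w j; have := lt_w j; rewrite inE /bile !ffunE -val_eqE /=.
move=> /implyP lt_t; rewrite leq_eqVlt => /predU1P[eq_w|->//].
by rewrite eq_w eqxx ltnn /= leqNgt; apply/negP=> /lt_t; rewrite eq_w ltnn.
Qed.

(** The pairs of a tabloid and an admissible [w] are exactly the sorted words of pairs, of which
    there is one for each matrix. *)
Lemma sum_fundamental N :
  (\sum_(t : tabloid la) fundamental (ascents t) N
     = \sum_(p : {ffun 'I_N -> 'I_n.+1} | wt p == n) content_monomial p *+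
         nchains (@lefun n N) (@wt _ _) (zerof n N) (nth 0%N la) (size la) p)%R.
Proof.
under eq_bigr do rewrite /fundamental (sum_monomials (card_ord n)).
rewrite exchange_big /=; apply: eq_bigr => p /eqP wt_p.
rewrite sumrMnr; congr (_ *+ _)%R.
rewrite -(card_sorted_biwords (intpartn_sum la) wt_p).
pose h (tw : tabloid la * {ffun 'I_n -> 'I_N}) := pair_word (val tw.1) tw.2.
have h_inj : injective h.
  move=> [t w] [t' w'] /ffunP eq_h; congr (_, _).
    by apply/val_inj/ffunP=> x; have := eq_h x; rewrite !ffunE => -[].
  by apply/ffunP=> x; have := eq_h x; rewrite !ffunE => -[].
under eq_bigr do rewrite -sum1dep_card.
rewrite (pair_big_dep xpredT) /= sum1dep_card -(card_imset _ h_inj).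
apply: eq_card => z; apply/imsetP/idP=> [[[t w]]|].
  rewrite inE /= -sorted_pair_word => /andP[so cont] ->.
  by rewrite inE /h /= pair_word_biwords cont.
rewrite inE => /andP[z_in so]; have [t [w eq_z]] := biwords_pair_word z_in.
rewrite eq_z in so z_in; exists (t, w) => //; rewrite inE /= -sorted_pair_word -(pair_word_biwords t) so.
exact: z_in.
Qed.

End Tabloids.

(** * Dominance order, Kostka numbers of partitions, orbits of pairs of tabloids *)

Section KostkaNumbers.
Variable n : nat.
Implicit Types la mu ka : intpartn n.

Definition Kostka_number mu la := Kostka (nth 0 la) (size la) (pshape mu).

Definition dominates mu la :=
  forall k, \sum_(0 <= i < k) nth 0 la i <= \sum_(0 <= i < k) nth 0 mu i.

(** A strictly monotone rank for dominance: it turns unitriangularity into vanishing conditions on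
    natural numbers and serves as induction measure. *)
Definition dom_rank la := \sum_(k < n.+1) \sum_(0 <= i < k) nth 0 la i.

Lemma dominates_rank mu la : dominates mu la -> mu = la \/ dom_rank la < dom_rank mu.
Proof.
move=> dom; have: dom_rank la <= dom_rank mu by apply: leq_sum => k _; apply: dom.
rewrite leq_eqVlt => /predU1P[eq_rank|]; last by right.
left; apply: shape_inj; apply: ext_inj => i; rewrite !ext_shape.
have eq_sum k : k < n.+1 -> \sum_(0 <= i < k) nth 0 la i = \sum_(0 <= i < k) nth 0 mu i.
  move=> lt_k; apply/eqP; rewrite eqn_leq dom /= leqNgt; apply/negP=> lt_sum.
  have: dom_rank la < dom_rank mu.
    rewrite /dom_rank (bigD1 (Ordinal lt_k)) //= [X in _ < X](bigD1 (Ordinal lt_k)) //=.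
    by rewrite -addSn leq_add // leq_sum.
  by rewrite eq_rank ltnn.
have [lt_in|le_ni] := ltnP i n; last by rewrite !nth_default ?(leq_trans (intpartn_size _)).
have := eq_sum i.+1 lt_in; rewrite !big_nat_recr //= eq_sum ?leqW // => /addnI.
by [].
Qed.

Lemma Kostka_number_dominates mu la : Kostka_number mu la != 0 -> dominates mu la.
Proof.
move=> nz k; have [le_k|lt_k] := leqP k (size la).
  have := Kostka_dominance nz le_k.
  by under [X in _ <= X]eq_bigr do rewrite ext_shape.
rewrite (big_cat_nat (leq0n _) (ltnW lt_k)) /= [X in _ + X]big_nat_cond.
rewrite [X in _ + X]big1 ?addn0 => [|i]; last first.
  by rewrite andbT => /andP[le_i _]; rewrite nth_default.
rewrite [X in _ <= X](big_cat_nat (leq0n _) (ltnW lt_k)) /=.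
apply: leq_trans (leq_addr _ _).
have := Kostka_dominance nz (leqnn _).
by under [X in _ <= X]eq_bigr do rewrite ext_shape.
Qed.

Lemma Kostka_number_diag la : Kostka_number la la = 1.
Proof.
have <- := @Kostka_diag n (size la) (pshape la); first 1 last.
- by move=> i; rewrite !ext_shape; apply: intpartn_anti.
- by move=> i le_i; rewrite ext_shape nth_default.
by apply: eq_nchains => i _; rewrite ext_shape.
Qed.

Lemma Kostka_number_eq0 mu la : mu <> la -> dom_rank mu <= dom_rank la -> Kostka_number mu la = 0.
Proof.
move=> ne le_rank; apply/eqP; apply/negPn/negP=> /Kostka_number_dominates/dominates_rank[] //.
by rewrite ltnNge le_rank.
Qed.

Lemma Kostka_anti s l (m : {ffun 'I_n.+1 -> 'I_n.+1}) : Kostka s l m != 0 ->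
  forall i, ext m i.+1 <= ext m i.
Proof.
case: l => [|l]; rewrite /Kostka /=.
  by rewrite eqb0 negbK => /eqP-> i; rewrite !ext_zerof.
rewrite sum_nat_eq0 negb_forall => /existsP[ka]; rewrite negb_imply.
by case/andP=> /andP[st _] _; apply: (hstrip_anti (ka := ka) (be := m)); rewrite st.
Qed.

(** A shape of [P] that ends some chain is nonincreasing of size [n], so only shapes of partitions
    contribute. *)
Lemma sum_Kostka_number la (g : {ffun 'I_n.+1 -> 'I_n.+1} -> nat) :
  \sum_m Kostka (nth 0 la) (size la) m * g m = \sum_mu Kostka_number mu la * g (pshape mu).
Proof.
rewrite (bigID (mem [set pshape mu | mu in predT])) /= [X in _ + X]big1 ?addn0 => [|m notin]; last first.
  have [->|nz] := eqVneq (Kostka (nth 0 la) (size la) m) 0; first by rewrite mul0n.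
  have [|mu eq_m] := shape_surj (Kostka_anti nz); last by rewrite -eq_m imset_f in notin.
  by rewrite (Kostka_size nz) intpartn_sum.
by rewrite big_imset //= => mu mu' _ _; apply: shape_inj.
Qed.

Definition margin la : {ffun 'I_(size la) -> 'I_n.+1} := trunc n _ (nth 0 la).

Lemma ext_margin la i : ext (margin la) i = nth 0 la i.
Proof.
have [lt_i|le_i] := ltnP i (size la); last by rewrite ext_default ?nth_default.
by rewrite ext_trunc // -ext_shape -[X in _ <= X](wt_shape la) ext_le_wt.
Qed.

Lemma wt_margin la : wt (margin la) = n.
Proof. by rewrite wtE; under eq_bigr do rewrite ext_margin; apply: intpartn_sum. Qed.

Lemma nchains_margin la ka :
  nchains (@lefun n (size ka)) (@wt _ _) (zerof n _) (nth 0 la) (size la) (margin ka)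
    = \sum_mu Kostka_number mu la * Kostka_number mu ka.
Proof.
rewrite -Kostka_Cauchy ?intpartn_sum // sum_Kostka_number; apply: eq_bigr => mu _.
by congr (_ * _); apply: eq_nchains => i _; rewrite ext_margin.
Qed.

Lemma sum_Schur_Kostka la N :
  (\sum_mu Schur_function mu N *+ Kostka_number mu la
    = \sum_(t : tabloid la) fundamental (ascents t) N)%R.
Proof.
rewrite sum_fundamental; under eq_bigr do rewrite Schur_Kostka -sumrMnl.
rewrite exchange_big; apply: eq_bigr => p _ /=.
rewrite -Kostka_Cauchy ?intpartn_sum // sum_Kostka_number -sumrMnr.
by apply: eq_bigr => mu _; rewrite mulnC mulrnA.
Qed.

Section Orbits.
Variables ka la : intpartn n.
Local Notation X := (tabloid ka * tabloid la)%type.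

Definition act_pair (x : X) (g : 'S_n) : X := (act_tabloid x.1 g, act_tabloid x.2 g).

Lemma act_pair1 x : act_pair x 1 = x.
Proof. by case: x => u t; rewrite /act_pair !act_tabloid1. Qed.

Lemma act_pairM x : act_morph act_pair x.
Proof. by move=> g h; rewrite /act_pair /= !act_tabloidM. Qed.

Definition pair_action : {action 'S_n &-> X} := TotalAction act_pair1 act_pairM.

Definition word_of_pair (x : X) := pair_word (val x.2) (val x.1).

Lemma word_of_pair_act x g y : word_of_pair (act_pair x g) y = word_of_pair x (g^-1%g y).
Proof. by rewrite !ffunE. Qed.

(** Two pairs of tabloids are conjugate when their words are rearrangements of each other, i.e. have
    the same matrix. *)
Lemma orbit_margin_chain x y :
  (orbit pair_action setT x == orbit pair_action setT y)
    = (margin_chain (word_of_pair x) == margin_chain (word_of_pair y)).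
Proof.
apply/eqP/eqP=> [/orbit_eqP/orbitP[g _ <-]|].
  apply: perm_margin_chain.
  apply/tuple_permP; exists (g^-1)%g; congr val; apply: eq_from_tnth => i.
  by rewrite !tnth_mktuple /= word_of_pair_act.
move=> /margin_chain_eq/perm_mktuple_act[g eq_g].
apply/orbit_eqP/orbitP; exists g; first by rewrite inE.
rewrite /= /act_pair; case: x y eq_g => u t [u' t'] eq_g; congr (_, _).
  by apply/val_inj/ffunP=> i; have := eq_g (g^-1 i)%g; rewrite !ffunE permKV => -[].
by apply/val_inj/ffunP=> i; have := eq_g (g^-1 i)%g; rewrite !ffunE permKV => -[].
Qed.

Lemma card_pair_orbits :
  #|[set orbit pair_action setT x | x in setT]| = \sum_mu Kostka_number mu la * Kostka_number mu ka.
Proof.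
rewrite -nchains_margin -card_chains -margin_chain_biwords ?intpartn_sum ?wt_margin //.
have -> : biwords (size la) (nth 0 la) (margin ka) = [set word_of_pair x | x in setT].
  apply/setP=> z; apply/idP/imsetP=> [z_in|[x _ ->]]; last first.
    rewrite pair_word_biwords; apply/forallP=> k.
    by rewrite (tabloidP (valP x.1)) -ext_ord ext_margin.
  have [t [w eq_z]] := biwords_pair_word z_in.
  have tab_w : is_tabloid w.
    apply/forallP=> k; move: z_in; rewrite eq_z pair_word_biwords => /forallP/(_ k).
    by rewrite -ext_ord ext_margin.
  by exists (exist (@is_tabloid n ka) w tab_w, t).
rewrite -imset_comp.
(* Reads the chain off any member of an orbit; the default is taken only on the empty set, which is
   not an orbit. *)
pose f (A : {set X}) := if [pick x in A] is Some x then margin_chain (word_of_pair x) else [ffun=> zerof n _].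
have f_orb x : f (orbit pair_action setT x) = margin_chain (word_of_pair x).
  rewrite /f; case: pickP => [y /orbit_eqP/eqP|/(_ x)]; last by rewrite orbit_refl.
  by rewrite orbit_margin_chain => /eqP.
rewrite -(@card_in_imset _ _ f) => [|_ _ /imsetP[x _ ->] /imsetP[y _ ->]]; last first.
  by rewrite !f_orb => /eqP; rewrite -orbit_margin_chain => /eqP.
by rewrite -imset_comp (eq_imset _ f_orb).
Qed.

End Orbits.

End KostkaNumbers.

(** * James's lemma and Specht modules *)

Section ColumnCounting.
Variables (n : nat) (mu la : intpartn n) (T : tableau mu) (t : tabloid la).

Lemma tableau_bij : exists g, cancel (val T) g /\ cancel g (val T).
Proof.
have [g gK Kg] : bijective (val T).
  by apply: (inj_card_bij (tableau_inj (T := T))); rewrite card_cell card_ord.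
by exists g.
Qed.

Lemma tableau_cell (c : cell mu) : exists x, val T x = c.
Proof. by have [g [_ Kg]] := tableau_bij; exists (g c). Qed.

Lemma tableau_ex r j : j < nth 0 mu r ->
  exists x, row_of (val T x) = r :> nat /\ col_of (val T x) = j.
Proof. by move=> /cell_ex[c [<- <-]]; have [x <-] := tableau_cell c; exists x. Qed.

Definition clash_free :=
  forall x y, col_of (val T x) = col_of (val T y) -> val t x = val t y -> x = y.

Definition col_below_t j k := [set x | (col_of (val T x) == j) && (val t x < k)].
Definition col_below_T j k := [set x | (col_of (val T x) == j) && (row_of (val T x) < k)].

Lemma intpartn_anti_leq (ka : intpartn n) i j : i <= j -> nth 0 ka j <= nth 0 ka i.
Proof. by apply: (nonincreasing_leq (f := nth 0 ka)) => r; apply: intpartn_anti. Qed.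

(** If column [j] of [T] reaches above its first [k] rows, it has a cell in each of them, and
    sending [x] to the letter of this column in row [t x] of [T] is injective, since no two letters
    of the column share a row of [t]. Otherwise the whole column lies below row [k]. *)
Lemma col_below_leq j k : clash_free -> #|col_below_t j k| <= #|col_below_T j k|.
Proof.
move=> free.
have [/existsP[y /andP[/eqP col_y le_ky]]|no_y] :=
    boolP [exists y, (col_of (val T y) == j) && (k <= row_of (val T y))]; last first.
  apply: subset_leq_card; apply/subsetP=> x; rewrite !inE => /andP[col_x _].
  rewrite col_x /= ltnNge; apply: contra no_y => le_kx.
  by apply/existsP; exists x; rewrite col_x.
have ex_z x : x \in col_below_t j k -> exists z, (col_of (val T z) == j) && (row_of (val T z) == val t x :> nat).
  rewrite inE => /andP[_ lt_xk].
  have [|z [rz cz]] := @tableau_ex (val t x) j; last by exists z; rewrite rz cz !eqxx.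
  rewrite -col_y; apply: leq_trans (col_lt _) (intpartn_anti_leq _ _).
  exact: leq_trans (ltnW lt_xk) le_ky.
pose f x := odflt x [pick z | (col_of (val T z) == j) && (row_of (val T z) == val t x :> nat)].
have fP x : x \in col_below_t j k -> col_of (val T (f x)) = j /\ row_of (val T (f x)) = val t x :> nat.
  move/ex_z=> [z Pz]; rewrite /f; case: pickP => [w /andP[/eqP-> /eqP->]|/(_ z)] //.
  by rewrite Pz.
rewrite -(@card_in_imset _ _ f) => [|x x' x_in x'_in eq_f]; last first.
  have [_ rx] := fP x x_in; have [_ ry] := fP x' x'_in.
  move: x_in x'_in; rewrite !inE => /andP[/eqP cx _] /andP[/eqP cy _].
  by apply: free; [rewrite cx cy | apply: val_inj; rewrite /= -rx -ry eq_f].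
apply: subset_leq_card; apply/subsetP=> _ /imsetP[x x_in ->].
have [cx rx] := fP x x_in; rewrite inE cx rx eqxx /=.
by move: x_in; rewrite inE => /andP[].
Qed.

Lemma col_bound x : col_of (val T x) < n.+1.
Proof.
apply: ltnW; apply: leq_trans (col_lt _) _.
by rewrite -ext_shape -[X in _ <= X](wt_shape mu) ext_le_wt.
Qed.

Lemma sum_col_below_t k :
  \sum_(j < n.+1) #|col_below_t j k| = #|[set x | val t x < k]|.
Proof.
rewrite -[RHS](card_partition_by _ (fun x => inord (col_of (val T x)) : 'I_n.+1)).
apply: eq_bigr => j _; apply: eq_card => x.
by rewrite !inE andbC -[inord _ == j]val_eqE /= inordK ?col_bound.
Qed.

Lemma sum_col_below_T k :
  \sum_(j < n.+1) #|col_below_T j k| = #|[set x | row_of (val T x) < k]|.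
Proof.
rewrite -[RHS](card_partition_by _ (fun x => inord (col_of (val T x)) : 'I_n.+1)).
apply: eq_bigr => j _; apply: eq_card => x.
by rewrite !inE andbC -[inord _ == j]val_eqE /= inordK ?col_bound.
Qed.

End ColumnCounting.

Section JamesLemma.
Variable n : nat.
Implicit Types mu la : intpartn n.

Lemma card_rows_lt la (t : tabloid la) k :
  #|[set x | val t x < k]| = \sum_(0 <= i < k) nth 0 la i.
Proof.
elim: k => [|k IHk]; first by rewrite big_geq // eq_card0 // => x; rewrite inE.
rewrite big_nat_recr //= -IHk; have [lt_k|le_k] := ltnP k (size la); last first.
  rewrite nth_default // addn0; apply: eq_card => x.
  by rewrite !inE !(leq_trans (ltn_ord _)) // leqW.
rewrite -(tabloidP (valP t) (Ordinal lt_k)) -cardsUI.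
rewrite [_ :&: _](_ : _ = set0) ?cards0 ?addn0.
  by apply: eq_card => x; rewrite !inE -val_eqE /= ltnS leq_eqVlt orbC.
apply/setP=> x; rewrite !inE -val_eqE /=; apply/negP=> /andP[lt1 /eqP eq1]; lia.
Qed.

Lemma card_tableau_rows_lt mu (T : tableau mu) k :
  #|[set x | row_of (val T x) < k]| = \sum_(0 <= i < k) nth 0 mu i.
Proof.
rewrite -(card_rows_lt (tabloid_of T)); apply: eq_card => x.
by rewrite !inE /= ffunE.
Qed.

Lemma clash_free_dominates mu la (T : tableau mu) (t : tabloid la) :
  clash_free T t -> dominates mu la.
Proof.
move=> free k; rewrite -(card_rows_lt t) -(card_tableau_rows_lt T).
rewrite -(sum_col_below_t T) -(sum_col_below_T T).
by apply: leq_sum => j _; apply: col_below_leq.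
Qed.

Lemma clash_free_col_stab mu (T : tableau mu) (t : tabloid mu) :
  clash_free T t -> exists2 h, h \in col_stab T & t = act_tabloid (tabloid_of T) h.
Proof.
move=> free.
(* For equal shapes the inequalities of all columns have the same total, so each is an equality. *)
have eq_below (j : 'I_n.+1) k : #|col_below_t T t j k| = #|col_below_T T j k|.
  have: \sum_(j < n.+1) #|col_below_t T t j k| = \sum_(j < n.+1) #|col_below_T T j k|.
    by rewrite sum_col_below_t sum_col_below_T card_rows_lt card_tableau_rows_lt.
  have le_below i := col_below_leq i k free.
  rewrite (bigD1 j) //= [in RHS](bigD1 j) //= => eq_sum; apply/eqP.
  have le_rest : \sum_(i < n.+1 | i != j) #|col_below_t T t i k| <=
    \sum_(i < n.+1 | i != j) #|col_below_T T i k| by apply: leq_sum.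
  rewrite eqn_leq le_below /= -(leq_add2r (\sum_(i < n.+1 | i != j) #|col_below_t T t i k|)).
  by rewrite eq_sum leq_add2l.
(* Passing from row [val t x] to the next strictly increases the count for [t], hence the count for
   [T]: the column of [x] has a cell in that row. *)
have ex_y x : exists y, row_of (val T y) = val t x /\ col_of (val T y) = col_of (val T x).
  set j := col_of (val T x); have lt_j : j < n.+1 := col_bound T x.
  have belowS : #|col_below_T T j (val t x)| < #|col_below_T T j (val t x).+1|.
    rewrite -!(eq_below (Ordinal lt_j)) /=; apply: proper_card; apply/properP; split.
      by apply/subsetP=> y; rewrite !inE => /andP[-> /leqW].
    by exists x; rewrite !inE ?eqxx /= ?ltnn ?leqnn.
  have [y y_in y_out] : exists2 y, y \in col_below_T T j (val t x).+1 & y \notin col_below_T T j (val t x).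
    by apply/subsetPn; apply: contraTN belowS => /subset_leq_card; rewrite -leqNgt.
  exists y; move: y_in y_out; rewrite !inE => /andP[/eqP-> lt_y]; rewrite eqxx /= -leqNgt => le_y.
  by split=> //; apply: val_inj; apply/eqP; rewrite eqn_leq le_y -ltnS lt_y.
have [y yP] := fin_all_exists ex_y.
have y_inj : injective y.
  move=> x x' eq_y; have [rx cx] := yP x; have [rx' cx'] := yP x'.
  by apply: free; [rewrite -cx -cx' eq_y | rewrite -rx -rx' eq_y].
exists (perm y_inj)^-1%g.
  rewrite inE; apply/forallP=> x; set z := (_ x).
  have -> : x = y z by rewrite -[LHS](permKV (perm y_inj)) permE.
  by have [_ ->] := yP z.
apply/val_inj/ffunP=> x; rewrite !ffunE invgK permE.
by have [-> _] := yP x.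
Qed.

End JamesLemma.

Local Open Scope ring_scope.



(** * Dimensions of spaces of intertwiners *)

(** In a full rank factorization [E = C R], idempotence forces [R C = 1], of size the rank of
    [E]. *)
Lemma mxtrace_idempotent (F : fieldType) k (E : 'M[F]_k) : E *m E = E ->
  \tr E = (\rank E)%:R.
Proof.
move=> idE; rewrite -{1}(mulmx_base E) mxtrace_mulC.
suff -> : row_base E *m col_base E = 1%:M by rewrite mxtrace1.
have [C' C'K] := row_fullP (col_base_full E).
have [R' R'K] := row_freeP (row_base_free E).
have: C' *m (col_base E *m row_base E *m (col_base E *m row_base E)) *m R'
    = C' *m (col_base E *m row_base E) *m R' by rewrite mulmx_base idE.
move: (col_base E) (row_base E) C'K R'K => C R C'K R'K.
by rewrite !mulmxA C'K !mul1mx -!mulmxA R'K !mulmx1.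
Qed.

Section IntertwinerSpace.
Variables (F : fieldType) (gT : finGroupType) (G : {group gT}) (d e : nat).
Variables (rU : mx_representation F G d) (rV : mx_representation F G e).

Definition intertwiner (f : 'M[F]_(d, e)) :=
  forall g, g \in G -> rU g *m f = f *m rV g.

Lemma mxtrace_lin_mulmx (A : 'M[F]_d) (B : 'M[F]_e) :
  \tr (lin_mulmx A *m lin_mulmxr B : 'M_(d * e)) = \tr A * \tr B.
Proof.
rewrite /mxtrace (reindex _ (curry_mxvec_bij d e)) /= mulr_suml.
pose L i j := (lin_mulmx A *m lin_mulmxr B) (mxvec_index i j) (mxvec_index i j).
rewrite (eq_bigr (fun p => L p.1 p.2)) => [|[i j] _] //.
rewrite -(pair_bigA _ L) /=.
apply: eq_bigr => i _; rewrite mulr_sumr; apply: eq_bigr => j _.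
transitivity (mxvec (A *m delta_mx i j *m B) 0 (mxvec_index i j)).
  rewrite -[RHS]/(mxvec (mulmxr B (A *m delta_mx i j)) 0 (mxvec_index i j)).
  rewrite -mul_vec_lin -[mxvec (A *m _)]mul_vec_lin mxvec_delta -mulmxA -rowE mxE.
  by [].
rewrite mxvecE !mxE (bigD1 j) //= big1 ?addr0 => [|k /negbTE ne_kj]; last first.
  rewrite !mxE big1 ?mul0r // => l _; by rewrite !mxE ne_kj andbF mulr0.
by rewrite !mxE (bigD1 i) //= big1 ?addr0 => [|k /negbTE ne_ki]; rewrite !mxE ?ne_ki ?mulr0 // !eqxx mulr1.
Qed.

(** The averaging operator on matrices flattened by [mxvec]. It projects onto the intertwiners, so
    [hom_rank] is the dimension of Hom(U, V), and its trace is the scalar product of the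
    characters. *)
Definition hom_mx : 'M[F]_(d * e) := (#|G|%:R)^-1 *:
  \sum_(g in G) lin_mulmx (rU g^-1%g) *m lin_mulmxr (rV g).

Definition hom_rank := \rank hom_mx.

Lemma hom_mxE f : mxvec f *m hom_mx
  = mxvec ((#|G|%:R)^-1 *: \sum_(g in G) rU g^-1%g *m f *m rV g).
Proof.
rewrite /hom_mx -scalemxAr mulmx_sumr [RHS]linearZ /= [X in _ = _ *: X]linear_sum /=.
by congr (_ *: _); apply: eq_bigr => g _; rewrite mulmxA !mul_vec_lin.
Qed.

Hypothesis unitG : #|G|%:R != 0 :> F.

Lemma intertwiner_avg f :
  intertwiner ((#|G|%:R)^-1 *: \sum_(g in G) rU g^-1%g *m f *m rV g).
Proof.
move=> h Gh; rewrite -scalemxAr -scalemxAl; congr (_ *: _).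
rewrite mulmx_sumr mulmx_suml (reindex_acts 'R _ Gh) ?astabsR //=.
apply: eq_bigr => g Gg; rewrite invMg !repr_mxM ?groupV // !mulmxA.
by rewrite -repr_mxM ?groupV // mulgV repr_mx1 mul1mx.
Qed.

Lemma avg_intertwiner f : intertwiner f ->
  (#|G|%:R)^-1 *: \sum_(g in G) rU g^-1%g *m f *m rV g = f.
Proof.
move=> hom_f; rewrite (eq_bigr (fun=> f)) => [|g Gg].
  by rewrite sumr_const -scaler_nat scalerA mulVf // scale1r.
by rewrite hom_f ?groupV // -mulmxA -repr_mxM ?groupV // mulVg repr_mx1 mulmx1.
Qed.

Lemma hom_mx_idem : hom_mx *m hom_mx = hom_mx.
Proof.
apply/row_matrixP=> i; rewrite !rowE mulmxA -[delta_mx 0 i]vec_mxK !hom_mxE.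
by rewrite avg_intertwiner //; apply: intertwiner_avg.
Qed.

Lemma hom_rankE : hom_rank%:R
  = (#|G|%:R)^-1 * \sum_(g in G) \tr (rU g^-1%g) * \tr (rV g).
Proof.
rewrite -(mxtrace_idempotent hom_mx_idem) /hom_mx mxtraceZ linear_sum /=.
by congr (_ * _); apply: eq_bigr => g _; rewrite mxtrace_lin_mulmx.
Qed.

Lemma hom_mxP f : reflect (intertwiner f) (mxvec f <= hom_mx)%MS.
Proof.
apply: (iffP submxP) => [[u def_f]|hom_f].
  have -> : f = (#|G|%:R)^-1 *: \sum_(g in G) rU g^-1%g *m vec_mx u *m rV g.
    by apply: (can_inj mxvecK); rewrite -hom_mxE vec_mxK.
  exact: intertwiner_avg.
by exists (mxvec f); rewrite hom_mxE avg_intertwiner.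
Qed.

Lemma hom_rank_eq0 : hom_rank = 0%N -> forall f, intertwiner f -> f = 0.
Proof.
move/eqP; rewrite mxrank_eq0 => /eqP hom0 f /hom_mxP.
by rewrite hom0 submx0 => /eqP/(canRL mxvecK); rewrite linear0.
Qed.

Lemma hom_rank_neq0 : hom_rank != 0%N -> exists2 f, intertwiner f & f != 0.
Proof.
rewrite mxrank_eq0 => /rowV0Pn[v v_hom nz_v]; exists (vec_mx v).
  by apply/hom_mxP; rewrite vec_mxK.
by apply: contraNneq nz_v => /(canRL vec_mxK) ->; rewrite linear0.
Qed.

Lemma hom_rank_scalar f0 : f0 != 0 -> intertwiner f0 ->
  (forall f, intertwiner f -> exists a, f = a *: f0) -> hom_rank = 1%N.
Proof.
move=> nz_f0 hom_f0 scal; rewrite /hom_rank.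
have -> : \rank hom_mx = \rank (mxvec f0).
  apply/eqP; rewrite eqn_leq !mxrankS //; first exact/hom_mxP.
  apply/row_subP=> i; have /hom_mxP/scal[a] : (mxvec (vec_mx (row i hom_mx)) <= hom_mx)%MS.
    by rewrite vec_mxK row_sub.
  by move/(congr1 mxvec); rewrite vec_mxK => ->; rewrite linearZ scalemx_sub.
by rewrite rank_rV mxvec_eq0 nz_f0.
Qed.

End IntertwinerSpace.

(** * Signed column sums, simplicity of the Specht modules and maps out of them *)

Section ColumnStabilizer.
Variables (n : nat) (mu : intpartn n) (T : tableau mu).

Lemma col_stab1 : 1%g \in col_stab T.
Proof. by rewrite inE; apply/forallP=> x; rewrite perm1. Qed.

Lemma col_stabM g h : g \in col_stab T -> h \in col_stab T -> (g * h)%g \in col_stab T.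
Proof.
rewrite !inE => /forallP gT /forallP hT; apply/forallP=> x.
by rewrite permM (eqP (hT _)) (eqP (gT _)).
Qed.

Lemma col_stabV g : g \in col_stab T -> (g^-1)%g \in col_stab T.
Proof.
rewrite !inE => /forallP gT; apply/forallP=> x.
by rewrite -(eqP (gT _)) permKV.
Qed.

Lemma reindex_col_stab (V : nmodType) h (f : 'S_n -> V) : h \in col_stab T ->
  \sum_(g in col_stab T) f g = \sum_(g in col_stab T) f (h * g)%g.
Proof.
move=> hT; rewrite (reindex_inj (mulgI h)); apply: eq_bigl => g.
apply/idP/idP=> [hgT|]; last exact: col_stabM.
by rewrite -(mulKg h g) col_stabM ?col_stabV.
Qed.

End ColumnStabilizer.

Section James.
Variables (F : fieldType) (n : nat).
Hypothesis char0 : [pchar F] =i pred0.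
Implicit Types mu la : intpartn n.

Lemma natr_eq0 k : (k%:R == 0 :> F) = (k == 0)%N.
Proof. by move/pcharf0P: char0 => ->. Qed.

(** Lets identities between dimensions be proved in [F], as identities between traces. *)
Lemma natr_inj : injective (fun k => k%:R : F).
Proof.
move=> i j /eqP; rewrite -subr_eq0; wlog le_ij : i j / (i <= j)%N.
  by case/orP: (leq_total i j) => [|/[swap] IH /IH]; last rewrite -opprB oppr_eq0;
     [move=> le IH; apply: IH | move=> IH' /IH' ->].
rewrite -oppr_eq0 opprB -natrB // natr_eq0 subn_eq0 => le_ji.
by apply/eqP; rewrite eqn_leq le_ij.
Qed.

Section Kappa.
Variables (mu la : intpartn n) (T : tableau mu).

(** The signed column sum of [T] acts on M^la for every [la], which allows the comparison of
    different shapes. *)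
Definition kappa : 'M[F]_#|{: tabloid la}| :=
  \sum_(g in col_stab T) (-1) ^+ odd_perm g *: perm_module_mx F la g.

Lemma perm_kappa h : h \in col_stab T ->
  perm_module_mx F la h *m kappa = (-1) ^+ odd_perm h *: kappa.
Proof.
move=> hT; rewrite [in RHS]/kappa (reindex_col_stab _ hT) scaler_sumr mulmx_sumr.
apply: eq_bigr => g _; rewrite -scalemxAr scalerA odd_permM signr_addb.
rewrite mulrA -signr_addb addbb mul1r.
have [_ M] := perm_module_subproof F la; by rewrite M ?inE.
Qed.

Lemma kappa_kappa : kappa *m kappa = #|col_stab T|%:R *: kappa.
Proof.
rewrite {1}/kappa mulmx_suml (eq_bigr (fun=> kappa)) => [|g gT].
  by rewrite sumr_const scaler_nat.
by rewrite -scalemxAl perm_kappa // scalerA -signr_addb addbb scale1r.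
Qed.

Lemma card_col_stab : (#|col_stab T|%:R != 0 :> F).
Proof. by rewrite natr_eq0 -lt0n; apply/card_gt0P; exists 1%g; apply: col_stab1. Qed.

(** If [x] and [y] share a column of [T] and a row of [t], their transposition fixes [t] but changes
    the sign of [kappa], so the image of [t] equals its opposite. *)
Lemma tabloid_kappa (t : tabloid la) :
  tabloid_vec F t *m kappa != 0 -> clash_free T t.
Proof.
move=> nz x y eq_c eq_r; apply: contraNeq nz => ne_xy; apply/eqP.
have tT : tperm x y \in col_stab T.
  by rewrite inE; apply/forallP=> z; case: tpermP => [->|->|] //; rewrite eq_c.
have act_t : act_tabloid t (tperm x y) = t.
  by apply/val_inj/ffunP=> z; rewrite ffunE tpermV; case: tpermP => [->|->|] //.
have := congr1 (mulmx (tabloid_vec F t)) (perm_kappa tT).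
rewrite mulmxA tabloid_vec_act act_t odd_tperm ne_xy expr1 scaleN1r mulmxN.
move/eqP; rewrite -addr_eq0 -mulr2n -scaler_nat scaler_eq0 natr_eq0 /=.
by move/eqP.
Qed.

End Kappa.

Lemma polytabloid_kappa mu (T : tableau mu) :
  polytabloid F T = tabloid_vec F (tabloid_of T) *m kappa mu T.
Proof.
rewrite mulmx_sumr; apply: eq_bigr => g _.
by rewrite -scalemxAr tabloid_vec_act act_tabloid_of.
Qed.

Lemma kappa_polytabloid mu (T : tableau mu) :
  polytabloid F T *m kappa mu T = #|col_stab T|%:R *: polytabloid F T.
Proof. by rewrite polytabloid_kappa -mulmxA kappa_kappa -scalemxAr. Qed.

(** A tabloid of shape [mu] that [kappa] does not kill comes from that of [T] by a column
    permutation, so its image is the polytabloid up to sign. *)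
Lemma kappa_line mu (T : tableau mu) : (kappa mu T <= polytabloid F T)%MS.
Proof.
apply/row_subP=> i; rewrite rowE.
have -> : delta_mx 0 i = tabloid_vec F (enum_val i) by rewrite /tabloid_vec enum_valK.
have [->|nz] := eqVneq (tabloid_vec F (enum_val i) *m kappa mu T) 0; first exact: sub0mx.
have [h hT ->] := clash_free_col_stab (tabloid_kappa nz).
rewrite -tabloid_vec_act -mulmxA perm_kappa // -scalemxAr -polytabloid_kappa.
exact: scalemx_sub.
Qed.

(** The tabloid of [T] has coefficient 1, since only the identity preserves both the columns and the
    rows of [T]. *)
Lemma polytabloid_neq0 mu (T : tableau mu) : polytabloid F T != 0.
Proof.
apply/eqP=> /rowP/(_ (enum_rank (tabloid_of T))); rewrite mxE summxE.
rewrite (bigD1 1%g) ?col_stab1 //= big1 => [|g /andP[gT ne_g]].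
  rewrite odd_perm1 expr0 scale1r addr0 -act_tabloid_of act_tabloid1 mxE !eqxx.
  by apply/eqP/oner_neq0.
rewrite !mxE eqxx /= (inj_eq enum_rank_inj).
case: eqP => [eq_t|]; last by rewrite mulr0.
case/eqP: ne_g; apply/permP=> x; rewrite perm1; apply: (tableau_inj (T := T)).
apply: cell_inj; last by move: gT; rewrite inE => /forallP/(_ x)/eqP.
have := congr1 (fun t : tabloid mu => val (val t (g x))) eq_t.
by rewrite /= !ffunE permK => ->.
Qed.

Lemma tableau_exists mu : exists T : tableau mu, true.
Proof.
pose f (x : 'I_n) : cell mu := enum_val (cast_ord (esym (card_cell mu)) x).
have inj_f : is_tableau (finfun f).
  by apply/injectiveP=> x y; rewrite !ffunE => /enum_val_inj/cast_ord_inj.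
by exists (exist (@is_tableau n mu) _ inj_f).
Qed.

Lemma tableau_act mu (T T' : tableau mu) : exists g, T' = act_tableau T g.
Proof.
have [i [Ti iT]] := tableau_bij T.
have inj_h : injective (fun x => i (val T' x)).
  by move=> x y /(can_inj iT)/(tableau_inj (T := T')).
exists (perm inj_h)^-1%g; apply/val_inj/ffunP=> x.
by rewrite ffunE invgK permE iT.
Qed.

Lemma Specht_sub mu m (T : tableau mu) (U : 'M[F]_(m, _)) :
  (forall g, (U *m perm_module_mx F mu g <= U)%MS) ->
  (polytabloid F T <= U)%MS -> (Specht_mx F mu <= U)%MS.
Proof.
move=> modU eU; apply/sumsmx_subP=> T' _; have [g ->] := tableau_act T T'.
rewrite genmxE -polytabloid_act; apply: submx_trans (modU g).
exact: submxMr.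
Qed.

Lemma polytabloid_Specht mu (T : tableau mu) : (polytabloid F T <= Specht_mx F mu)%MS.
Proof. by apply: (sumsmx_sup T); rewrite ?genmxE. Qed.

Lemma Sn_pcharF : pgroup.pgroup [pchar F]^' [set: 'S_n].
Proof.
apply/andP; split; first exact: cardG_gt0.
by apply/allP=> p _; rewrite inE /= char0.
Qed.

(** James's submodule argument, with a Maschke complement [W] of [U] instead of an orthogonal one.
    The polytabloid of [T] is not killed by [kappa], so one of its components in [U] and [W] is not;
    the image of that component is a nonzero multiple of the polytabloid, which generates. The case
    of [W] contradicts that [U] is nonzero and inside the Specht module. *)
Lemma Specht_simple mu : mxsimple (perm_module F mu) (Specht_mx F mu).
Proof.
have [T _] := tableau_exists mu.
split; first exact: Specht_module.
  by apply: contraNneq (polytabloid_neq0 T) => S0; rewrite -submx0 -S0 polytabloid_Specht.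
move=> U modU sUS nzU.
have [W modW sumUW dirUW] := mx_Maschke_pchar (perm_module F mu) Sn_pcharF modU (submx1 U).
have in_mod V (v : 'rV_#|{: tabloid mu}|) : mxmodule (perm_module F mu) V -> (v <= V)%MS ->
    v *m kappa mu T != 0 -> (Specht_mx F mu <= V)%MS.
  move=> modV sv nz; have modV' g : (V *m perm_module_mx F mu g <= V)%MS.
    by apply: (mxmoduleP modV); rewrite inE.
  apply: (Specht_sub (T := T)) => //.
  have /sub_rVP[a def_v] : (v *m kappa mu T <= polytabloid F T)%MS.
    exact: submx_trans (submxMl _ _) (kappa_line T).
  have nz_a : a != 0 by apply: contraNneq nz => a0; rewrite def_v a0 scale0r.
  rewrite -(eqmx_scale _ nz_a) -def_v mulmx_sumr; apply: summx_sub => g _.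
  rewrite -scalemxAr scalemx_sub //; apply: submx_trans (modV' g).
  exact: submxMr.
have: (polytabloid F T <= U + W)%MS by rewrite sumUW submx1.
case/sub_addsmxP=> -[u w] /= def_e.
have [uk0|] := eqVneq (u *m U *m kappa mu T) 0; last by apply: in_mod; rewrite // submxMl.
have [wk0|] := eqVneq (w *m W *m kappa mu T) 0.
  have := kappa_polytabloid T; rewrite {1}def_e mulmxDl uk0 wk0 addr0 => /esym/eqP.
  by rewrite scaler_eq0 (negbTE (card_col_stab _)) (negbTE (polytabloid_neq0 T)).
move/(in_mod _ _ _ modW (submxMl _ _)) => sSW; case/negP: nzU.
by rewrite -submx0 -(mxdirect_addsP dirUW) sub_capmx submx_refl (submx_trans sUS).
Qed.

Section Hom.
Variables (mu la : intpartn n) (f : 'M[F]_(\rank (Specht_mx F mu), #|{: tabloid la}|)).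
Hypothesis hom_f : intertwiner (Specht F mu) (perm_module F la) f.

(** A linear extension of [f] to M^mu, used as an equivariant map on the Specht module only. *)
Let ext_f := in_submod (Specht_mx F mu) 1%:M *m f.

Lemma ext_fE m (v : 'M_(m, _)) : v *m ext_f = in_submod (Specht_mx F mu) v *m f.
Proof. by rewrite [in_submod _ v]in_submodE -mulmxA. Qed.

Lemma Specht_hom_act m (v : 'M_(m, _)) g : (v <= Specht_mx F mu)%MS ->
  v *m perm_module_mx F mu g *m ext_f = v *m ext_f *m perm_module_mx F la g.
Proof.
move=> sv; rewrite !ext_fE.
rewrite -[perm_module_mx F mu g]/(perm_module F mu g) (in_submodJ (Specht_module F mu)) //.
by rewrite -[LHS]mulmxA -[RHS]mulmxA; congr (_ *m _); apply: (hom_f (in_setT g)).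
Qed.

Lemma Specht_hom_eq0 (T : tableau mu) : polytabloid F T *m ext_f = 0 -> f = 0.
Proof.
move=> e0; have S0 : (Specht_mx F mu <= kermx ext_f :&: Specht_mx F mu)%MS.
  apply: (Specht_sub (T := T)) => [g|].
    rewrite sub_capmx; apply/andP; split; last first.
      apply: submx_trans (submxMr _ (capmxSr _ _)) _.
      by apply: (mxmoduleP (Specht_module F mu)); rewrite inE.
    apply/sub_kermxP; rewrite Specht_hom_act ?capmxSr //.
    by rewrite (sub_kermxP (capmxSl _ _)) mul0mx.
  by rewrite sub_capmx polytabloid_Specht andbT; apply/sub_kermxP.
have: (val_submod (1%:M : 'M_(\rank (Specht_mx F mu))) <= kermx ext_f)%MS.
  by rewrite val_submod1; apply: submx_trans S0 (capmxSl _ _).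
by move/sub_kermxP; rewrite ext_fE val_submodK mul1mx.
Qed.

Lemma Specht_hom_kappa (T : tableau mu) :
  polytabloid F T *m ext_f *m kappa la T = #|col_stab T|%:R *: (polytabloid F T *m ext_f).
Proof.
rewrite scalemxAl -kappa_polytabloid /kappa !mulmx_sumr mulmx_suml.
apply: eq_bigr => g _; rewrite -!scalemxAr -scalemxAl.
by rewrite Specht_hom_act // polytabloid_Specht.
Qed.

(** The image of the polytabloid of [T] is nonzero and is multiplied by the order of the column
    stabilizer under [kappa la T]. Thus [kappa la T] is nonzero, and some tabloid of shape [la] has
    no clash with [T]. *)
Lemma Specht_hom_dominates : f != 0 -> dominates mu la.
Proof.
move=> nz_f; have [T _] := tableau_exists mu.
have: polytabloid F T *m ext_f *m kappa la T != 0.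
  rewrite Specht_hom_kappa scaler_eq0 negb_or card_col_stab /=.
  by apply: contraNneq nz_f => /Specht_hom_eq0 ->.
move=> nz.
have [i nz_i] : exists i, row i (kappa la T) != 0.
  apply/existsP; apply: contraNT nz; rewrite negb_exists => /forallP k0.
  rewrite (_ : kappa la T = 0) ?mulmx0 ?eqxx //; apply/row_matrixP=> i; rewrite row0.
  exact/eqP/negbNE/k0.
apply: (clash_free_dominates (T := T) (t := enum_val i)); apply: tabloid_kappa.
by move: nz_i; rewrite rowE /tabloid_vec enum_valK.
Qed.

End Hom.

Lemma Specht_rank_neq0 mu : \rank (Specht_mx F mu) != 0%N.
Proof. by rewrite mxrank_eq0; case: (Specht_simple mu). Qed.

Lemma Specht_incl mu : intertwiner (Specht F mu) (perm_module F mu) (val_submod 1%:M).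
Proof.
move=> g Gg; rewrite -(val_submodJ (Specht_module F mu)) // mul1mx.
by rewrite [RHS]val_submodE.
Qed.

Lemma Specht_incl_neq0 mu : val_submod (1%:M : 'M_(\rank (Specht_mx F mu))) != 0.
Proof.
apply: contraNneq (Specht_rank_neq0 mu) => v0.
have: \rank (val_submod (1%:M : 'M_(\rank (Specht_mx F mu)))) = \rank (Specht_mx F mu).
  by rewrite val_submod1.
by rewrite v0 mxrank0 => <-.
Qed.

(** The image of the polytabloid lies in the image of [kappa], the line of the polytabloid itself;
    subtracting this multiple of the inclusion kills a generator. *)
Lemma Specht_hom_scalar mu f : intertwiner (Specht F mu) (perm_module F mu) f ->
  exists a, f = a *: val_submod 1%:M.
Proof.
move=> hom_f; have [T _] := tableau_exists mu.
have /sub_rVP[a def_a] : (polytabloid F T *m (in_submod (Specht_mx F mu) 1%:M *m f) <= polytabloid F T)%MS.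
  rewrite -(eqmx_scale _ (card_col_stab T)) -(Specht_hom_kappa hom_f).
  exact: submx_trans (submxMl _ _) (kappa_line T).
exists a; apply/eqP; rewrite -subr_eq0; apply/eqP.
apply: (Specht_hom_eq0 _ (T := T)).
  move=> g Gg; rewrite mulmxBr mulmxBl hom_f // -scalemxAr -scalemxAl.
  by rewrite Specht_incl.
rewrite mulmxBr mulmxBr def_a -!scalemxAr mulmxA -in_submodE.
by rewrite -val_submodE in_submodK ?polytabloid_Specht // subrr.
Qed.

End James.

(** * Young's rule *)

Section Schur.
Variables (F : fieldType) (gT : finGroupType) (G : {group gT}) (d e : nat).
Variables (rU : mx_representation F G d) (rV : mx_representation F G e).

Lemma intertwiner_rsim f : mx_irreducible rU -> mx_irreducible rV ->
  intertwiner rU rV f -> f != 0 -> mx_rsim rU rV.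
Proof.
move=> [_ _ simU] [_ _ simV] hom_f nz_f.
have free_f : row_free f.
  rewrite -kermx_eq0; apply: contraNT nz_f => nz_k.
  have: (1%:M <= kermx f)%MS.
    apply: simU; rewrite ?submx1 //; apply/mxmoduleP=> g Gg; apply/sub_kermxP.
    by rewrite -mulmxA hom_f // mulmxA mulmx_ker mul0mx.
  by move/sub_kermxP; rewrite mul1mx => ->.
have full_f : row_full f.
  have: (1%:M <= <<f>>)%MS.
    apply: simV; rewrite ?submx1 //; last by rewrite -submx0 genmxE submx0.
    apply/mxmoduleP=> g Gg; rewrite (eqmxMr _ (genmxE _)) genmxE -hom_f //.
    exact: submxMl.
  by rewrite genmxE sub1mx.
apply: (MxReprSim (B := f)) => //.
by rewrite -(eqP free_f) (eqP full_f).
Qed.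

End Schur.

Lemma intertwiner_mul (F : fieldType) (gT : finGroupType) (G : {group gT}) d1 d2 d3
    (r1 : mx_representation F G d1) (r2 : mx_representation F G d2)
    (r3 : mx_representation F G d3) f f' :
  intertwiner r1 r2 f -> intertwiner r2 r3 f' -> intertwiner r1 r3 (f *m f').
Proof. by move=> hom_f hom_f' g Gg; rewrite mulmxA hom_f // -!mulmxA hom_f'. Qed.

Section HomRank.
Variables (F : fieldType) (n : nat).
Hypothesis char0 : [pchar F] =i pred0.
Implicit Types mu la ka : intpartn n.
Local Notation G := [set: 'S_n]%G.

Lemma card_Sn_neq0 : #|G|%:R != 0 :> F.
Proof. by rewrite natr_eq0 // -lt0n cardG_gt0. Qed.

Lemma eq_hom_rank d e d' e' (rU : Sn_module F n d) (rV : Sn_module F n e)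
    (rU' : Sn_module F n d') (rV' : Sn_module F n e') :
  mx_rsim rU rU' -> mx_rsim rV rV' -> hom_rank rU rV = hom_rank rU' rV'.
Proof.
move=> simU simV; apply: (natr_inj char0); rewrite /= !(hom_rankE _ _ card_Sn_neq0).
congr (_ * _); apply: eq_bigr => g Gg.
by rewrite (mxtrace_rsim simU) ?groupV // (mxtrace_rsim simV).
Qed.

Lemma hom_rank_sumr d e (I : finType) (k : I -> nat) (rU : Sn_module F n d)
    (rV : Sn_module F n e) (dW : I -> nat) (rW : forall i, Sn_module F n (dW i)) :
  (forall g, \tr (rV g) = \sum_i (k i)%:R * \tr (rW i g)) ->
  hom_rank rU rV = (\sum_i k i * hom_rank rU (rW i))%N.
Proof.
move=> trV; apply: (natr_inj char0); rewrite /= natr_sum (hom_rankE _ _ card_Sn_neq0).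
under [RHS]eq_bigr do rewrite natrM (hom_rankE _ _ card_Sn_neq0) mulrCA mulr_sumr.
rewrite -mulr_sumr exchange_big; congr (_ * _); apply: eq_bigr => g _.
by rewrite trV mulr_sumr; apply: eq_bigr => i _; rewrite mulrCA.
Qed.

Lemma hom_rank_suml d e (I : finType) (k : I -> nat) (rU : Sn_module F n d)
    (rV : Sn_module F n e) (dW : I -> nat) (rW : forall i, Sn_module F n (dW i)) :
  (forall g, \tr (rU g) = \sum_i (k i)%:R * \tr (rW i g)) ->
  hom_rank rU rV = (\sum_i k i * hom_rank (rW i) rV)%N.
Proof.
move=> trU; apply: (natr_inj char0); rewrite /= natr_sum (hom_rankE _ _ card_Sn_neq0).
under [RHS]eq_bigr do rewrite natrM (hom_rankE _ _ card_Sn_neq0) mulrCA mulr_sumr.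
rewrite -mulr_sumr exchange_big; congr (_ * _); apply: eq_bigr => g _.
by rewrite trU mulr_suml; apply: eq_bigr => i _; rewrite mulrA.
Qed.

Lemma mxtrace_perm_module la g :
  \tr (perm_module F la g) = #|[set t : tabloid la | act_tabloid t g == t]|%:R.
Proof.
rewrite /mxtrace -sum1_card natr_sum [RHS]big_mkcond /=.
rewrite (reindex _ (onW_bij _ (@enum_rank_bij (tabloid la)))) /=; apply: eq_bigr => t _.
rewrite mxE enum_rankK mxE eqxx inE (inj_eq enum_rank_inj) eq_sym /=.
by case: (_ == _).
Qed.

(** Cauchy-Frobenius: a product of two permutation characters counts fixed pairs. The inverse in the
    trace formula is harmless, as [g] and its inverse have the same fixed points. *)
Lemma hom_rank_perm ka la :
  hom_rank (perm_module F ka) (perm_module F la) = (\sum_mu Kostka_number mu ka * Kostka_number mu la)%N.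
Proof.
apply: (natr_inj char0); rewrite /= (hom_rankE _ _ card_Sn_neq0).
have actsX : [acts G, on setT | pair_action ka la].
  by apply/actsP=> g _ x; rewrite !inE.
have := Frobenius_Cauchy actsX; rewrite card_pair_orbits => FC.
apply: (mulfI card_Sn_neq0); rewrite mulrA divff ?card_Sn_neq0 // mul1r.
rewrite mulrC -natrM.
under [in RHS]eq_bigr do rewrite mulnC.
rewrite -FC natr_sum; apply: eq_bigr => g _.
rewrite !mxtrace_perm_module -natrM -cardsX; congr _%:R; apply: eq_card => -[u t].
rewrite !inE /= sub1set inE /act_pair xpair_eqE; congr (_ && _).
apply/eqP/eqP=> u_g; rewrite -{1}u_g -act_tabloidM ?mulVg ?mulgV; exact: act_tabloid1.
Qed.

Lemma Specht_irr mu : mx_irreducible (Specht F mu).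
Proof. by apply/submod_mx_irr; apply: Specht_simple. Qed.

(** Isomorphic Specht modules embed into the permutation modules of each other's shapes, so the two
    shapes dominate each other. *)
Lemma hom_rank_Specht mu nu : hom_rank (Specht F mu) (Specht F nu) = (mu == nu).
Proof.
have [<-|ne] := eqVneq mu nu.
  have rk := Specht_rank_neq0 char0 mu.
  apply: (hom_rank_scalar card_Sn_neq0 (f0 := 1%:M)).
  - by apply: contraNneq rk => /(congr1 mxrank); rewrite mxrank1 mxrank0 => ->.
  - by move=> g _; rewrite mulmx1 mul1mx.
  move=> f hom_f; have [|a def_a] := Specht_hom_scalar char0 (f := f *m val_submod 1%:M).
    exact: intertwiner_mul hom_f (Specht_incl F mu).
  exists a; apply: (can_inj val_submodK).
  by rewrite val_submodE def_a [RHS]val_submodE scalemx1 mul_scalar_mx.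
apply/eqP/negPn/negP=> nz; case/eqP: ne.
have [f hom_f nz_f] := hom_rank_neq0 card_Sn_neq0 nz.
have dom mu1 mu2 : mx_rsim (Specht F mu1) (Specht F mu2) -> dominates mu1 mu2.
  case=> B _ free_B hom_B.
  apply: (Specht_hom_dominates char0 (f := B *m val_submod 1%:M)).
    exact: intertwiner_mul hom_B (Specht_incl F mu2).
  apply: contraNneq (Specht_rank_neq0 char0 mu1) => Bv0.
  have B0 : B = 0 by apply: (can_inj val_submodK); rewrite val_submodE Bv0 linear0.
  by move/eqP: free_B; rewrite B0 mxrank0 => <-.
have sim := intertwiner_rsim (Specht_irr mu) (Specht_irr nu) hom_f nz_f.
have [//|lt1] := dominates_rank (dom _ _ sim).
have [//|lt2] := dominates_rank (dom _ _ (mx_rsim_sym sim)).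
by have := ltn_trans lt1 lt2; rewrite ltnn.
Qed.

End HomRank.

Lemma sum_count_mem (V : nmodType) (I : finType) (s : seq I) (f : I -> V) :
  \sum_(i <- s) f i = \sum_i f i *+ count_mem i s.
Proof.
elim: s => [|j s IHs]; first by rewrite big_nil big1.
have countS i : count_mem i (j :: s) = ((j == i) + count_mem i s)%N by [].
rewrite big_cons IHs; under [RHS]eq_bigr do rewrite countS mulrnDr.
rewrite big_split /=; congr (_ + _).
by rewrite (bigD1 j) //= eqxx mulr1n big1 ?addr0 // => i /negbTE ne; rewrite eq_sym ne.
Qed.

Section YoungRule.
Variables (F : fieldType) (n : nat).
Hypothesis char0 : [pchar F] =i pred0.
Implicit Types mu la ka : intpartn n.
Local Notation G := [set: 'S_n]%G.
Local Notation mult mu la := (hom_rank (Specht F mu) (perm_module F la)).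
Let unitG := card_Sn_neq0 n char0.

Lemma mult_diag la : mult la la = 1%N.
Proof.
apply: (hom_rank_scalar unitG (Specht_incl_neq0 char0 la) (Specht_incl F la)).
exact: Specht_hom_scalar.
Qed.

Lemma mult_eq0 mu la : mu <> la -> (dom_rank mu <= dom_rank la)%N -> mult mu la = 0%N.
Proof.
move=> ne le_rank; apply/eqP/negPn/negP=> nz.
have [f hom_f nz_f] := hom_rank_neq0 unitG nz.
have [//|] := dominates_rank (Specht_hom_dominates char0 hom_f nz_f).
by rewrite ltnNge le_rank.
Qed.

(** Young's rule for characters, which is all that dimensions of Hom require of M^ka. *)
Definition Young_trace ka := forall g,
  \tr (perm_module F ka g) = \sum_mu (Kostka_number mu ka)%:R * \tr (Specht F mu g).

Definition rank_max := (\max_(mu : intpartn n) dom_rank mu)%N.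

Lemma leq_rank_max mu : (dom_rank mu <= rank_max)%N.
Proof. exact: leq_bigmax. Qed.

(* Both [mult] and [Kostka_number] are unitriangular, and they have the same Gram matrix. *)
Lemma mult_Kostka la :
  (forall ka, (dom_rank la < dom_rank ka)%N -> Young_trace ka) ->
  forall ka, mult ka la = Kostka_number ka la.
Proof.
move=> young ka; have [k] := ubnP (rank_max - dom_rank ka)%N.
elim: k ka => // k IHk ka; rewrite ltnS => le_k.
have [le_rank|lt_rank] := leqP (dom_rank ka) (dom_rank la).
  have [->|/eqP ne] := eqVneq ka la; first by rewrite mult_diag Kostka_number_diag.
  by rewrite mult_eq0 // Kostka_number_eq0.
have := hom_rank_perm char0 ka la.
rewrite (hom_rank_suml char0 _ (young _ lt_rank)).
(* Terms of rank above that of [ka] agree by induction and the others vanish, so the terms at [ka]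
   must agree. *)
rewrite (bigD1 ka) //= [in RHS](bigD1 ka) //= Kostka_number_diag !mul1n.
rewrite [X in (_ + X)%N = _](eq_bigr (fun mu => Kostka_number mu ka * Kostka_number mu la)%N) => [/addIn //|mu /eqP ne].
have [lt_mu|le_mu] := ltnP (dom_rank ka) (dom_rank mu); last by rewrite Kostka_number_eq0.
rewrite IHk //; apply: leq_trans _ le_k.
by have := leq_rank_max mu; lia.
Qed.

Lemma Young_rule_semisimple la :
  (forall ka, (dom_rank la < dom_rank ka)%N -> Young_trace ka) ->
  mxsemisimple (perm_module F la) 1%:M ->
  exists mus : seq (intpartn n),
    mx_rsim (perm_module F la)
      (\big[dadd_grepr/grepr0]_(mu <- mus) Representation (Specht F mu))
    /\ forall mu, count_mem mu mus = Kostka_number mu la.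
Proof.
move=> young [I U S simU defS dirS].
have multE := mult_Kostka young.
pose modU i := mxsimple_module (simU i).
pose W i := submod_repr (modU i).
have irrW i : mx_irreducible (W i) by apply/submod_mx_irr.
have mod1 := mxmodule1 (perm_module F la).
have trW g : \tr (perm_module F la g) = \sum_i 1%:R * \tr (W i g).
  under eq_bigr do rewrite mul1r.
  rewrite (mxtrace_dsum_mod modU mod1 defS dirS) ?in_setT //.
  by rewrite (mxtrace_rsim (rsim_submod1 mod1 _)) ?in_setT.
(* Summed over [i], [r] and [h] give the Kostka numbers and their sum of squares, before any [W i]
   is identified. *)
pose r mu i := hom_rank (Specht F mu) (W i).
pose h i := hom_rank (W i) (perm_module F la).
have sum_r mu : (\sum_i r mu i)%N = Kostka_number mu la.
  rewrite -multE (hom_rank_sumr char0 _ trW).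
  by apply: eq_bigr => i _; rewrite mul1n.
have sum_h : (\sum_i h i)%N = (\sum_mu Kostka_number mu la * Kostka_number mu la)%N.
  rewrite -(hom_rank_perm char0) (hom_rank_suml char0 _ trW).
  by apply: eq_bigr => i _; rewrite mul1n.
have simP i nu : mx_rsim (W i) (Specht F nu) ->
    (forall mu, r mu i = (mu == nu)) /\ h i = Kostka_number nu la.
  move=> sim; split=> [mu|]; last first.
    by rewrite -multE; apply: eq_hom_rank sim (mx_rsim_refl _).
  by rewrite -(hom_rank_Specht char0); apply: eq_hom_rank (mx_rsim_refl _) sim.
have ex_sim i : r^~ i =1 (fun=> 0%N) \/ exists nu, mx_rsim (W i) (Specht F nu).
  have [/existsP[nu nz]|none] := boolP [exists nu, r nu i != 0%N].
    right; exists nu; apply: mx_rsim_sym; have [f hom_f nz_f] := hom_rank_neq0 unitG nz.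
    exact: intertwiner_rsim (Specht_irr char0 nu) (irrW i) hom_f nz_f.
  left=> nu; apply/eqP/negPn; apply: contra none => nz; apply/existsP.
  by exists nu.
have h_gt0 i : (0 < h i)%N.
  rewrite lt0n; apply/eqP=> h0.
  have [_ nzU _] := simU i.
  have: val_submod (1%:M : 'M_(\rank (U i))) = 0.
    apply: (hom_rank_eq0 unitG h0) => g Gg.
    by rewrite -(val_submodJ (modU i)) // mul1mx [RHS]val_submodE.
  move=> v0; case/eqP: nzU; apply/eqP; rewrite -mxrank_eq0.
  by rewrite -(val_submod1 (U i)) v0 mxrank0.
have le_h i : (\sum_mu r mu i * Kostka_number mu la <= h i)%N.
  have [r0|[nu /simP[rE ->]]] := ex_sim i.
    by rewrite big1 // => mu _; rewrite r0.
  rewrite (bigD1 nu) //= rE eqxx mul1n big1 ?addn0 // => mu /negbTE ne.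
  by rewrite rE ne.
(* A summand that is no Specht module has [r] zero but [h] positive, as it embeds into M^la; it
   would make [le_h] strict after summation, whereas both totals are the same sum of squares. *)
have all_sim i : exists nu, mx_rsim (W i) (Specht F nu).
  have [r0|//] := ex_sim i.
  have: (\sum_i \sum_mu r mu i * Kostka_number mu la < \sum_i h i)%N.
    rewrite (bigD1 i) //= [X in (_ < X)%N](bigD1 i) //= -addSn leq_add //.
      by rewrite big1 // => mu _; rewrite r0.
    by apply: leq_sum => j _.
  rewrite exchange_big sum_h /=.
  rewrite (eq_bigr (fun mu => Kostka_number mu la * Kostka_number mu la)%N) ?ltnn // => mu _.
  by rewrite -big_distrl sum_r.
have [nu nuP] := fin_all_exists all_sim.
exists [seq nu i | i <- index_enum I]; split; last first.
  move=> mu; rewrite -sum_r count_map -sum1_count big_mkcond.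
  apply: eq_bigr => i _; have [-> _] := simP i _ (nuP i).
  by rewrite /= eq_sym; case: (_ == _).
rewrite big_map.
apply: mx_rsim_trans (mx_rsim_sym (rsim_submod1 mod1 _)) _ => //.
exact: (mx_rsim_dsum (rU := fun i => Representation (Specht F (nu i))) mod1 defS dirS nuP).
Qed.

Lemma Young_rule la : exists mus : seq (intpartn n),
    mx_rsim (perm_module F la)
      (\big[dadd_grepr/grepr0]_(mu <- mus) Representation (Specht F mu))
    /\ forall mu, count_mem mu mus = Kostka_number mu la.
Proof.
have [k] := ubnP (rank_max - dom_rank la)%N.
elim: k la => // k IHk la; rewrite ltnS => le_k.
have young ka : (dom_rank la < dom_rank ka)%N -> Young_trace ka.
  move=> lt_ka; have [|mus [sim cnt]] := IHk ka.
    by apply: leq_trans _ le_k; have := leq_rank_max ka; lia.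
  move=> g; rewrite (mxtrace_rsim sim) ?in_setT //.
  have -> : \tr ((\big[dadd_grepr/grepr0]_(mu <- mus) Representation (Specht F mu)) g)
      = \sum_(mu <- mus) \tr (Specht F mu g).
    elim: mus {sim cnt} => [|mu mus IH]; first by rewrite !big_nil mxtrace1.
    by rewrite !big_cons /= mxtrace_block IH.
  by rewrite sum_count_mem; apply: eq_bigr => mu _; rewrite cnt mulr_natl.
(* Over an arbitrary field, the decomposition into simple modules holds under a double negation,
   removed by the excluded middle. *)
apply: NNPP => no_dec.
suff: false by [].
have mod1 := mxmodule1 (perm_module F la).
apply: (mx_reducible_semisimple mod1 (mx_Maschke_pchar _ (Sn_pcharF n char0))).
by move=> ss; case: no_dec; apply: Young_rule_semisimple.
Qed.

End YoungRule.

(** * The 0-Hecke action on tabloids *)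

Section TabloidBasis.
Variables (F : fieldType) (n : nat) (la : intpartn n).
Local Notation v := (@tabloid_vec F n la).
Local Notation d := #|{: tabloid la}|.

Lemma codom_tabloid_vec (i : 'I_d) : (codom_tuple v)`_i = delta_mx 0 i.
Proof.
by rewrite /= nth_codom /tabloid_vec enum_valK.
Qed.

Lemma sum_tabloid_vec (k : 'I_d -> F) :
  \sum_(i < d) k i *: (codom_tuple v)`_i = \row_i k i.
Proof.
under eq_bigr do rewrite codom_tabloid_vec.
rewrite [RHS]row_sum_delta; apply: eq_bigr => i _; by rewrite mxE.
Qed.

Lemma free_tabloid_vec : free (codom_tuple v).
Proof.
by apply/freeP=> k; rewrite sum_tabloid_vec => /rowP k0 i; have := k0 i; rewrite !mxE.
Qed.

Lemma tabloid_vec_basis : basis_family v.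
Proof.
rewrite /basis_family basisEfree subvf free_tabloid_vec /=.
by rewrite dimvf dim_matrix mul1r size_codom.
Qed.

Lemma coef_tabloid_vec w t : coef v w t = w 0 (enum_rank t).
Proof.
rewrite /coef -[w in LHS](_ : \sum_(i < d) w 0 i *: (codom_tuple v)`_i = w).
  by rewrite coord_sum_free // free_tabloid_vec.
by rewrite sum_tabloid_vec; apply/rowP=> i; rewrite mxE.
Qed.

Lemma coef_vec t x : coef v (v t) x = (x == t)%:R.
Proof. by rewrite coef_tabloid_vec mxE eqxx (inj_eq enum_rank_inj). Qed.

Lemma tabloid_vec_inj : injective v.
Proof.
move=> t x /(congr1 (fun w => coef v w t)); rewrite !coef_vec eqxx.
by case: eqP => // _ /eqP; rewrite oner_eq0.
Qed.

End TabloidBasis.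

Section HeckeAction.
Variables (F : fieldType) (n : nat) (la : intpartn n) (le : rel (tabloid la)).
Hypothesis char0 : [pchar F] =i pred0.
Hypothesis le_total : total_order le.
Hypothesis le_prec : forall s t : tabloid la, tabloid_prec s t -> le s t.
Local Notation v := (@tabloid_vec F n la).
Local Notation d := #|{: tabloid la}|.
Local Notation M := (perm_module F la).
Implicit Types (t x y : tabloid la) (i j : 'I_n.-1).

Definition swap i t := act_tabloid t (simple_transp i).
Definition tab_row t (a : 'I_n) : nat := val t a.

Lemma vec_swap i t : v t *m M (simple_transp i) = v (swap i t).
Proof. exact: tabloid_vec_act. Qed.

Lemma letter_neq i : letter i != letter_succ i.
Proof. by rewrite -val_eqE /= neq_ltn ltnSn. Qed.

Lemma swapE i t a : tab_row (swap i t) a = tab_row t (tperm (letter i) (letter_succ i) a).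
Proof. by rewrite /tab_row ffunE tpermV. Qed.

Lemma swapL i t : tab_row (swap i t) (letter i) = tab_row t (letter_succ i).
Proof. by rewrite swapE tpermL. Qed.

Lemma swapR i t : tab_row (swap i t) (letter_succ i) = tab_row t (letter i).
Proof. by rewrite swapE tpermR. Qed.

Lemma swapD i t a : letter i != a -> letter_succ i != a -> tab_row (swap i t) a = tab_row t a.
Proof. by move=> ne1 ne2; rewrite swapE tpermD. Qed.

Lemma tab_row_inj x y : tab_row x =1 tab_row y -> x = y.
Proof. by move=> eq_xy; apply/val_inj/ffunP=> a; apply/val_inj/eq_xy. Qed.

Lemma swap_id i t : tab_row t (letter i) = tab_row t (letter_succ i) -> swap i t = t.
Proof.
move=> eq_r; apply: tab_row_inj => a; rewrite swapE.
by case: tpermP => [->|->|].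
Qed.

Lemma swap_neq i t : tab_row t (letter i) != tab_row t (letter_succ i) -> swap i t != t.
Proof. by apply: contraNneq => eq_t; rewrite -{1}eq_t swapL. Qed.

(** The smallest letter whose row changes is [letter i], which moves up to the row of its
    successor. *)
Lemma swap_prec i t : (tab_row t (letter i) < tab_row t (letter_succ i))%N ->
  tabloid_prec t (swap i t).
Proof.
move=> lt_r; apply/existsP; exists (letter i); apply/andP; split; last first.
  by have := swapL i t; rewrite /tab_row => ->.
apply/forallP=> a; apply/implyP=> lt_a; apply/eqP/val_inj.
by move: lt_a; rewrite -[RHS]/(tab_row _ a) /= => lt_a; rewrite [RHS]swapD // -val_eqE /=; lia.
Qed.

Lemma le_swap i t : (tab_row t (letter i) < tab_row t (letter_succ i))%N -> le t (swap i t).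
Proof. by move/swap_prec/le_prec. Qed.

Lemma swapK i : involutive (swap i).
Proof.
by move=> t; rewrite /swap -act_tabloidM tperm2 act_tabloid1.
Qed.

Lemma le_swap_gt i t : (tab_row t (letter_succ i) < tab_row t (letter i))%N -> le (swap i t) t.
Proof.
by move=> lt_r; rewrite -{2}[t](swapK i); apply: le_swap; rewrite swapL swapR.
Qed.

Lemma le_anti x y : le x y -> le y x -> x = y.
Proof. by case: le_total => _ anti _ _ xy yx; apply: anti; rewrite xy yx. Qed.

Lemma trailing_term_vec t : trailing_term v le (v t) = v t.
Proof.
have [refl_le _ _ _] := le_total.
rewrite /trailing_term; case: pickP => [x /andP[]|/(_ t)].
  by rewrite coef_vec; have [->|_] := eqVneq x t; rewrite ?scale1r ?eqxx.
rewrite coef_vec eqxx oner_neq0 /= => /forallPn[y].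
by rewrite coef_vec; have [->|_] := eqVneq y t; rewrite ?eqxx ?refl_le ?implybT.
Qed.

Lemma killsE i t : kills M v le i t = (swap i t == t).
Proof. by rewrite /kills vec_swap trailing_term_vec (inj_eq (@tabloid_vec_inj _ _ _)). Qed.

Lemma vec_eqN x y : (v x == - v y) = false.
Proof.
apply/eqP=> /(congr1 (fun w => coef v w y)); rewrite coef_vec coef_tabloid_vec !mxE.
rewrite !eqxx /= => /eqP; rewrite -subr_eq0 opprK -natrD (natr_eq0 char0).
by rewrite addn1.
Qed.

Lemma negatesE i t : negates M v le i t = (t != swap i t) && le t (swap i t).
Proof.
rewrite /negates vec_swap vec_eqN orbF; apply/existsP/idP=> [[x /andP[lt_x]]|lt_x].
  by rewrite (inj_eq (@tabloid_vec_inj _ _ _)) => /eqP->.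
by exists (swap i t); rewrite lt_x eqxx.
Qed.

Lemma lowersE i t : lowers M v le i t = (swap i t != t) && le (swap i t) t.
Proof.
rewrite /lowers vec_swap; apply/existsP/idP=> [[x /andP[lt_x]]|lt_x].
  by rewrite (inj_eq (@tabloid_vec_inj _ _ _)) => /eqP->.
by exists (swap i t); rewrite lt_x eqxx.
Qed.

Lemma one_case i t : [|| kills M v le i t, negates M v le i t | lowers M v le i t].
Proof.
rewrite killsE negatesE lowersE [t == _]eq_sym; case: eqP => //= _.
by have [_ _ _ tot] := le_total; apply: tot.
Qed.

(** The order is consulted only on [t] and [swap i t], where [tabloid_prec] already decides; the
    operators are thus the same for all extensions. *)
Lemma pi_basisE i t : pi_basis M v le i t =
  if tab_row t (letter i) == tab_row t (letter_succ i) then 0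
  else if (tab_row t (letter i) < tab_row t (letter_succ i))%N then - v t else v (swap i t).
Proof.
rewrite /pi_basis killsE negatesE lowersE vec_swap.
have [eq_r|ne_r] := eqVneq (tab_row t (letter i)) (tab_row t (letter_succ i)).
  by rewrite swap_id // eqxx.
rewrite [t == _]eq_sym (negbTE (swap_neq ne_r)) /=.
move: ne_r; rewrite neq_ltn; case: ltnP => /= [lt_r _|_ lt_r].
  by rewrite le_swap.
rewrite le_swap_gt //; case: ifP => // le_t.
have ne : tab_row t (letter i) != tab_row t (letter_succ i) by rewrite neq_ltn lt_r orbT.
by case/eqP: (swap_neq ne); apply: le_anti => //; apply: le_swap_gt.
Qed.

Local Notation Pi := (pi_bar M v le).

Lemma vec_pi i t : v t *m Pi i =
  if tab_row t (letter i) == tab_row t (letter_succ i) then 0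
  else if (tab_row t (letter i) < tab_row t (letter_succ i))%N then - v t else v (swap i t).
Proof.
rewrite -pi_basisE -rowE; apply/rowP=> k; rewrite !mxE.
rewrite -[delta_mx _ _]/(v t) (bigD1 t) //= coef_vec eqxx scale1r big1 ?addr0 // => x.
by rewrite coef_vec => /negbTE->; rewrite scale0r.
Qed.

Lemma eq_on_vec (A B : 'M[F]_d) : (forall t, v t *m A = v t *m B) -> A = B.
Proof.
move=> eqAB; apply/row_matrixP=> k; rewrite !rowE.
by have := eqAB (enum_val k); rewrite /tabloid_vec enum_valK.
Qed.

Lemma letter_far i j : (i.+2 <= j)%N || (j.+2 <= i)%N ->
  [/\ letter i != letter j, letter i != letter_succ j,
      letter_succ i != letter j & letter_succ i != letter_succ j].
Proof. by rewrite -!val_eqE /= => far; split; apply/eqP; case/orP: far; lia. Qed.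

Lemma transp_far i j : (i.+2 <= j)%N || (j.+2 <= i)%N ->
  (simple_transp i * simple_transp j = simple_transp j * simple_transp i)%g.
Proof.
move=> /letter_far[n1 n2 n3 n4].
by rewrite conjgC tpermJ !tpermD // eq_sym.
Qed.

(** Both sides are conjugates of a transposition, equal to the exchange of the outer two of the
    three letters. *)
Lemma transp_braid i j : j = i.+1 :> nat ->
  (simple_transp i * simple_transp j * simple_transp i
     = simple_transp j * simple_transp i * simple_transp j)%g.
Proof.
move=> ji; have eq_l : letter j = letter_succ i by apply: val_inj.
have ne := letter_neq i; have ne' := letter_neq j.
have ne2 : letter i != letter_succ j by rewrite -val_eqE /= ji; lia.
have conjE i1 i2 : (simple_transp i1 * simple_transp i2 * simple_transp i1
    = simple_transp i2 ^ simple_transp i1)%g.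
  by rewrite conjgE /simple_transp tpermV mulgA.
rewrite !conjE /simple_transp !tpermJ eq_l in ne' *.
by rewrite tpermR tpermL tpermD // tpermD // eq_sym.
Qed.

Lemma vec_pi_eq i t : tab_row t (letter i) = tab_row t (letter_succ i) -> v t *m Pi i = 0.
Proof. by rewrite vec_pi => ->; rewrite eqxx. Qed.

Lemma vec_pi_lt i t : (tab_row t (letter i) < tab_row t (letter_succ i))%N ->
  v t *m Pi i = - v t.
Proof. by rewrite vec_pi => lt_r; rewrite ltn_eqF ?lt_r. Qed.

Lemma vec_pi_gt i t : (tab_row t (letter_succ i) < tab_row t (letter i))%N ->
  v t *m Pi i = v (swap i t).
Proof. by rewrite vec_pi => lt_r; rewrite gtn_eqF // ltnNge (ltnW lt_r). Qed.

(** Applies a product of operators to a tabloid when the comparisons of its rows are in the context;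
    [rows] computes the rows after swaps. *)
Ltac eval_pi rows := repeat first
  [ rewrite mul0mx | rewrite mulNmx
  | rewrite vec_pi_eq; last (by rewrite ?rows; lia)
  | rewrite vec_pi_lt; last (by rewrite ?rows; lia)
  | rewrite vec_pi_gt; last (by rewrite ?rows; lia) ].

Lemma pi_idem i : Pi i *m Pi i = - Pi i.
Proof.
apply: eq_on_vec => t; rewrite mulmxA mulmxN.
have rows := (swapL, swapR).
by case: (ltngtP (tab_row t (letter i)) (tab_row t (letter_succ i))) => r_t;
  eval_pi rows; rewrite ?oppr0.
Qed.

Lemma pi_far i j : (i.+2 <= j)%N || (j.+2 <= i)%N -> Pi i *m Pi j = Pi j *m Pi i.
Proof.
move=> far; have [n1 n2 n3 n4] := letter_far far.
have swap_far t : swap i (swap j t) = swap j (swap i t).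
  by rewrite /swap -!act_tabloidM transp_far // orbC.
have e1 t : tab_row (swap i t) (letter j) = tab_row t (letter j) by rewrite swapD.
have e2 t : tab_row (swap i t) (letter_succ j) = tab_row t (letter_succ j) by rewrite swapD.
have e3 t : tab_row (swap j t) (letter i) = tab_row t (letter i).
  by rewrite swapD // eq_sym.
have e4 t : tab_row (swap j t) (letter_succ i) = tab_row t (letter_succ i).
  by rewrite swapD // eq_sym.
have rows := (e1, e2, e3, e4).
apply: eq_on_vec => t; rewrite !mulmxA.
by case: (ltngtP (tab_row t (letter i)) (tab_row t (letter_succ i))) => r_i;
  case: (ltngtP (tab_row t (letter j)) (tab_row t (letter_succ j))) => r_j;
  eval_pi rows; rewrite ?oppr0 ?opprK ?swap_far.
Qed.

Lemma pi_braid i j : j = i.+1 :> nat ->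
  Pi i *m Pi j *m Pi i = Pi j *m Pi i *m Pi j.
Proof.
move=> ji; have eq_l : letter_succ i = letter j by apply: val_inj.
have ne := letter_neq i; have ne' := letter_neq j.
have ne2 : letter i != letter_succ j by rewrite -val_eqE /= ji; lia.
have swap_braid t : swap i (swap j (swap i t)) = swap j (swap i (swap j t)).
  by rewrite /swap -!act_tabloidM !mulgA transp_braid.
have e1 t : tab_row (swap i t) (letter i) = tab_row t (letter j) by rewrite swapL eq_l.
have e2 t : tab_row (swap i t) (letter j) = tab_row t (letter i) by rewrite -eq_l swapR.
have e3 t : tab_row (swap i t) (letter_succ j) = tab_row t (letter_succ j).
  by rewrite swapD // eq_l.
have e4 t : tab_row (swap j t) (letter i) = tab_row t (letter i).
  by rewrite swapD // eq_sym // -eq_l.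
have rows := (eq_l, e1, e2, e3, e4, swapL, swapR).
apply: eq_on_vec => t; rewrite !mulmxA.
(* The relative order of the rows of three letters determines both sides; [lia] discards the
   inconsistent combinations. *)
by case: (ltngtP (tab_row t (letter i)) (tab_row t (letter j))) => r1;
  case: (ltngtP (tab_row t (letter j)) (tab_row t (letter_succ j))) => r2;
  case: (ltngtP (tab_row t (letter i)) (tab_row t (letter_succ j))) => r3;
  try lia; eval_pi rows; rewrite ?oppr0 ?opprK ?swap_braid.
Qed.

Lemma pi_Hecke0 : Hecke0_action Pi.
Proof. by split; [apply: pi_idem | apply: pi_far | apply: pi_braid]. Qed.

End HeckeAction.

(** * The composition series of initial spans *)

Section Filtration.
Variables (F : fieldType) (n : nat) (la : intpartn n) (le : rel (tabloid la)).
Hypothesis char0 : [pchar F] =i pred0.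
Hypothesis le_total : total_order le.
Hypothesis le_prec : forall s t : tabloid la, tabloid_prec s t -> le s t.
Local Notation v := (@tabloid_vec F n la).
Local Notation d := #|{: tabloid la}|.
Local Notation Pi := (pi_bar (perm_module F la) v le).
Implicit Types t x : tabloid la.

Definition tabloids_by_le : seq (tabloid la) := sort le (enum {: tabloid la}).
Local Notation srt := tabloids_by_le.

Lemma mem_srt t : t \in srt. Proof. by rewrite mem_sort mem_enum. Qed.

Lemma index_srt_lt t x : le t x -> t != x -> (index t srt < index x srt)%N.
Proof.
have [refl_le anti trans_le tot] := le_total => le_tx ne_tx.
rewrite ltnNge leq_eqVlt; apply/negP=> /predU1P[eq_i|lt_i].
  by case/eqP: ne_tx; apply/esym/(index_inj t (mem_srt x) (mem_srt t) eq_i).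
have le_xt := sorted_ltn_index trans_le (sort_sorted tot _) _ _ (mem_srt x) (mem_srt t) lt_i.
by case/eqP: ne_tx; apply: anti; rewrite le_tx.
Qed.

(* Its row space is the span of the [j] smallest tabloids. *)
Definition initial_span (j : nat) : 'M[F]_d :=
  diag_mx (\row_k (index (enum_val k) srt < j)%N%:R).

Lemma initial_spanP m (A : 'M[F]_(m, d)) j :
  reflect (forall i t, (j <= index t srt)%N -> A i (enum_rank t) = 0)
          (A <= initial_span j)%MS.
Proof.
apply: (iffP submxP) => [[B ->] i t le_j|A0].
  rewrite /initial_span mul_mx_diag !mxE enum_rankK ltnNge le_j mulr0; by [].
exists A; apply/matrixP=> i k; rewrite /initial_span mul_mx_diag !mxE.
case: ltnP => [_|/A0]; first by rewrite mulr1.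
by rewrite enum_valK mulr0.
Qed.

Lemma vec_initial_span t j : (index t srt < j)%N -> (v t <= initial_span j)%MS.
Proof.
move=> lt_j; apply/initial_spanP=> i x le_j; rewrite mxE (inj_eq enum_rank_inj).
by have [eq_x|_] := eqVneq x t; [move: le_j; rewrite eq_x leqNgt lt_j | rewrite andbF].
Qed.

Lemma initial_span_vec j k :
  row k (initial_span j) = (index (enum_val k) srt < j)%N%:R *: v (enum_val k).
Proof. by rewrite row_diag_mx mxE /tabloid_vec enum_valK. Qed.

(** An operator kills a tabloid, negates it, or replaces it with a smaller one. *)
Lemma initial_span_stable j : Hecke0_stable Pi (initial_span j).
Proof.
move=> i; apply/row_subP=> k; rewrite row_mul initial_span_vec -scalemxAl.
case: ltnP => [lt_j|_]; last by rewrite scale0r sub0mx.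
rewrite scale1r (vec_pi char0 le_total le_prec).
case: ifP => [_|/negbT ne_r]; first exact: sub0mx.
case: ifP => [_|/negbT ge_r]; first by rewrite eqmx_opp vec_initial_span.
apply: vec_initial_span; apply: leq_ltn_trans lt_j; apply/ltnW/index_srt_lt.
  by apply: le_swap_gt => //; rewrite ltn_neqAle eq_sym ne_r leqNgt.
exact: swap_neq.
Qed.

Lemma initial_span_quotient (t := tnth (in_tuple srt)) (j : 'I_(size srt)) :
  quotient_iso Pi (initial_span j.+1) (initial_span j)
    (Hecke0_simple F (ascents (t j))).
Proof.
have srt_uniq : uniq srt by rewrite sort_uniq enum_uniq.
have index_t : index (t j) srt = j.
  by rewrite /t (tnth_nth (t j)) index_uniq.
have t_index x : index x srt = j -> x = t j.
  by move=> eq_j; apply: (index_inj x (mem_srt x) (mem_srt _)); rewrite eq_j index_t.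
(* The quotient map reads the coefficient of the newest tabloid. *)
pose f : 'M[F]_(d, 1) := delta_mx (enum_rank (t j)) 0.
have mulf m (A : 'M[F]_(m, d)) : A *m f = col (enum_rank (t j)) A.
  by rewrite colE.
exists f; split.
- rewrite -sub1mx; apply: submx_trans (submxMr f (vec_initial_span (t := t j) _)); last first.
    by rewrite index_t.
  rewrite mulf; apply/submxP; exists 1%:M; rewrite mul1mx.
  by apply/matrixP=> a b; rewrite !mxE !ord1 !eqxx.
- apply/eqmxP/andP; split.
    apply/initial_spanP=> i x; rewrite leq_eqVlt => /predU1P[eq_j|lt_j].
      rewrite (t_index x) //.
      have /sub_kermxP := capmxSr (initial_span j.+1) (kermx f).
      by rewrite mulf => /matrixP/(_ i 0); rewrite !mxE.
    by have /initial_spanP-> := capmxSl (initial_span j.+1) (kermx f).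
  rewrite sub_capmx; apply/andP; split.
    apply/initial_spanP=> i x lt_j.
    by have /initial_spanP-> := submx_refl (initial_span j); rewrite // ltnW.
  apply/sub_kermxP; rewrite mulf; apply/matrixP=> i b; rewrite [LHS]mxE [RHS]mxE.
  have /initial_spanP := submx_refl (initial_span j); apply.
  by rewrite index_t.
move=> i; apply/row_matrixP=> k; rewrite !row_mul initial_span_vec -!scalemxAl.
case: ltnP => [lt_j|_]; last by rewrite !scale0r.
congr (_ *: _); rewrite (vec_pi char0 le_total le_prec) /Hecke0_simple inE.
set x := enum_val k; rewrite !mulf -/(tab_row _ _) -/(tab_row _ _).
have col_v y : col (enum_rank (t j)) (v y) = (t j == y)%:R%:M.
  by apply/matrixP=> a b; rewrite !ord1 !mxE eqxx (inj_eq enum_rank_inj) mulr1n.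
rewrite col_v; have [<-|ne_x] := eqVneq (t j) x.
  case: ltngtP => [_|gt_r|_]; last by rewrite linear0 mulmx0.
    by rewrite linearN /= col_v eqxx mul1mx.
  rewrite col_v eq_sym (negbTE (swap_neq _)); last by rewrite neq_ltn gt_r orbT.
  by rewrite mulmx0 raddf0.
rewrite mul_scalar_mx scale0r.
case: ltngtP => [_|gt_r|_]; last exact: linear0.
  by rewrite linearN /= col_v (negbTE ne_x) raddf0 oppr0.
(* A swap that lowers [x] cannot reach [t j], since [x] comes no later than [t j] in the order. *)
rewrite col_v; have [eq_t|_] := eqVneq (t j) (swap i x); last exact: raddf0.
have := index_srt_lt (le_swap_gt le_prec gt_r) (swap_neq _).
rewrite -eq_t index_t neq_ltn gt_r orbT => /(_ isT) lt_jx.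
by have := leq_trans lt_jx lt_j; rewrite ltnn.
Qed.

Lemma FQchar_pi_bar :
  FQchar Pi (fun N => \sum_(t : tabloid la) fundamental (ascents t) N).
Proof.
exists [seq ascents t | t <- srt]; split; last first.
  move=> N; rewrite big_map /tabloids_by_le (perm_big _ (permEl (perm_sort _ _))) /=.
  by rewrite big_enum.
exists initial_span; rewrite size_map; split.
- apply/eqP; rewrite -submx0; apply/row_subP=> k.
  by rewrite initial_span_vec scale0r sub0mx.
- apply/eqmxP; rewrite submx1; apply/initial_spanP=> i t.
  by rewrite leqNgt index_mem mem_srt.
- by move=> j _; apply: initial_span_stable.
move=> j lt_j; split.
  apply/initial_spanP=> i t lt_jt; have /initial_spanP := submx_refl (initial_span j).
  by apply; apply: ltnW.
have x0 : tabloid la := tnth (in_tuple srt) (Ordinal lt_j).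
have := initial_span_quotient (Ordinal lt_j).
by rewrite (nth_map x0) // (tnth_nth x0).
Qed.

End Filtration.

Theorem theorem3 (F : fieldType) (char0 : [pchar F]%R =i pred0)
    (n : nat) (la : intpartn n) (le : rel (tabloid la))
    (le_total : total_order le)
    (le_prec : forall s t : tabloid la, tabloid_prec s t -> le s t) :
  SQCC (perm_module F la) (@tabloid_vec F n la) le.
Proof.
split.
- by split; last exact: tabloid_vec_basis.
- exact: one_case.
- exact: pi_Hecke0.
exists (fun N => \sum_(t : tabloid la) fundamental (ascents t) N); split.
  exact: FQchar_pi_bar.
have [mus [sim cnt]] := Young_rule char0 la; exists mus; split=> // N.
rewrite -sum_Schur_Kostka [RHS]sum_count_mem; apply: eq_bigr => mu _.
by rewrite cnt.
Qed.
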